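(* Let $c\neq0$ and $\eta>0$ be real constants and let $\mathcal U\subset\{x\in\mathbb R^n:4c^2|x|^2<1\}$ be open and convex. Then $$\overline F=\frac{\eta\left(\sqrt{|y|^2-4c^2\left(|x|^2|y|^2-\langle x,y\rangle^2\right)}+2c\langle x,y\rangle\right)^2}{(1-4c^2|x|^2)^2\sqrt{|y|^2-4c^2\left(|x|^2|y|^2-\langle x,y\rangle^2\right)}}$$ is a projectively flat Finsler metric on $\mathcal U$ of zero flag curvature, and its projective factor is proportional (with a constant coefficient) to the projectively flat Randers metric $$F=\frac{\sqrt{|y|^2-4c^2\left(|x|^2|y|^2-\langle x,y\rangle^2\right)}}{1-4c^2|x|^2}+\frac{2c\langle x,y\rangle}{1-4c^2|x|^2}.$$
   Context: $|\cdot|$, $\langle\cdot,\cdot\rangle$ are the Euclidean norm and inner product; $(x^i,y^i)$ are the canonical coordinates on $\mathcal U\times\mathbb R^n$, $n\ge2$; $\mathcal C=y^i\frac{\partial}{\partial y^i}$, $J=dx^i\otimes\frac{\partial}{\partial y^i}$, $d_Ju=\frac{\partial u}{\partial y^i}dx^i$. A Finsler metric is a continuous function $F$, smooth and positive for $y\ne0$, positively $1$-homogeneous in $y$, with $\frac12\frac{\partial^2F^2}{\partial y^i\partial y^j}$ of rank $n$ for $y\neq0$; such expressions are extended by $0$ at $y=0$. Its geodesic spray is the unique vector field $S=y^i\frac{\partial}{\partial x^i}-2G^i\frac{\partial}{\partial y^i}$ with $i_S\,dd_JF^2=-dF^2$. $F$ is projectively flat if its geodesic spray is $S_0-2P\mathcal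 C$, where $S_0=y^i\frac{\partial}{\partial x^i}$ and $P$ is $1$-homogeneous in $y$; $P=\frac{S_0F}{2F}$ is its projective factor. With $N^i_j=\partial G^i/\partial y^j$, $\frac{\delta}{\delta x^i}=\frac{\partial}{\partial x^i}-N^j_i\frac{\partial}{\partial y^j}$ and $\Phi=R^i_j\frac{\partial}{\partial y^i}\otimes dx^j$, $R^i_j=2\frac{\delta G^i}{\delta x^j}-S(N^i_j)+N^i_kN^k_j$, $F$ has constant flag curvature $\kappa$ if $\Phi=\kappa F^2J-\kappa F\,d_JF\otimes\mathcal C$ with $\kappa$ constant; zero flag curvature means $\kappa=0$. *)

(* Defs.v *)
From HB Require Import structures.
From mathcomp Require Import all_boot all_order all_algebra.
From mathcomp Require Import all_classical all_reals all_analysis.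

Set Implicit Arguments.
Unset Strict Implicit.
Unset Printing Implicit Defensive.

Import Order.TTheory GRing.Theory Num.Theory.
Import numFieldNormedType.Exports.

Local Open Scope classical_set_scope.
Local Open Scope ring_scope.

Section Smooth.
Context {R : realType} {V W : normedModType R}.

(* C^k on an open subset A of a finite-dimensional space V. *)
Fixpoint Ck_on (k : nat) (A : set V) (f : V -> W) : Prop :=
  match k with
  | 0 => {in A, continuous f}
  | k'.+1 => (forall p, A p -> differentiable f p) /\
             (forall v : V, Ck_on k' A (fun p => 'D_v f p))
  end.

Definition smooth_on (A : set V) (f : V -> W) : Prop :=
  forall k, Ck_on k A f.

End Smooth.

Section Euclidean.
Context {R : realType} {n : nat}.

Definition dotp (x y : 'rV[R]_n) : R := \sum_(i < n) x 0 i * y 0 i.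

(* The library norm of 'rV[R]_n is the sup norm, hence this definition. *)
Definition enorm (x : 'rV[R]_n) : R := Num.sqrt (dotp x x).

End Euclidean.

(* A point p = (x, y) of the tangent bundle U x R^n of an open set U of R^n is
   an element of V * V with V = 'rV[R]_n. Functions, vector fields and forms are
   total on V * V; only their values over U are meaningful, and for fields and
   forms only those at y <> 0. Vector fields are maps V * V -> V * V,
   with (a, b) standing for a^i d/dx^i + b^i d/dy^i, and 1-forms are maps
   V * V -> V * V -> R, linear in the second argument. *)
Section Finsler.
Context {R : realType} {n : nat}.
Notation V := 'rV[R]_n.
Notation TV := ('rV[R]_n * 'rV[R]_n)%type.

Definition tangent (U : set V) : set TV := [set p | U p.1].
Definition slit_tangent (U : set V) : set TV := [set p | U p.1 /\ p.2 != 0].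

Definition ex (i : 'I_n) : TV := (delta_mx 0 i, 0).
Definition ey (i : 'I_n) : TV := (0, delta_mx 0 i).

Definition d_dx (i : 'I_n) (f : TV -> R) : TV -> R := fun p => 'D_(ex i) f p.
Definition d_dy (i : 'I_n) (f : TV -> R) : TV -> R := fun p => 'D_(ey i) f p.

(* Action X(f) of a vector field on a function. *)
Definition act (X : TV -> TV) (f : TV -> R) : TV -> R := fun p => 'D_(X p) f p.

Definition liouville (p : TV) : TV := (0, p.2).
Definition Jmap (v : TV) : TV := (0, v.1).
Definition S0 (p : TV) : TV := (p.2, 0).

(* d_J u = (du/dy^i) dx^i *)
Definition dJ (u : TV -> R) (p v : TV) : R := \sum_(i < n) d_dy i u p * v.1 0 i.

(* Exterior derivative of a 1-form w:
   dw(u, v) = u(w(v)) - v(w(u)) for constant vector fields u, v. *)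
Definition ext_d (w : TV -> TV -> R) (p u v : TV) : R :=
  'd (fun q => w q v) p u - 'd (fun q => w q u) p v.

(* Positive homogeneity of degree 1 in y, over U. *)
Definition homogeneous1 (U : set V) (f : TV -> R) : Prop :=
  forall (x y : V) (t : R), U x -> 0 < t -> f (x, t *: y) = t * f (x, y).

Definition sq (F : TV -> R) : TV -> R := fun p => F p ^+ 2.

Definition fundamental (F : TV -> R) (p : TV) : 'M[R]_n :=
  \matrix_(i < n, j < n) (2^-1 * d_dy i (d_dy j (sq F)) p).

Definition finsler_metric (U : set V) (F : TV -> R) : Prop :=
  [/\ {within tangent U, continuous F},
      smooth_on (slit_tangent U) F,
      (forall p, slit_tangent U p -> 0 < F p),
      homogeneous1 U F &
      (forall p, slit_tangent U p -> \rank (fundamental F p) = n)].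

(* S = y^i d/dx^i - 2 G^i d/dy^i *)
Definition spray (G : TV -> V) (p : TV) : TV := (p.2, - (2 *: G p)).

(* S is a vector field of the form y^i d/dx^i - 2 G^i d/dy^i on the slit tangent
   bundle with i_S d d_J F^2 = - d F^2. For a Finsler metric F these conditions
   determine S there, since the fundamental tensor has rank n. *)
Definition is_geodesic_spray (U : set V) (F : TV -> R) (S : TV -> TV) : Prop :=
  [/\ smooth_on (slit_tangent U) S,
      (forall p, slit_tangent U p -> (S p).1 = p.2) &
      (forall p v, slit_tangent U p ->
         ext_d (dJ (sq F)) p (S p) v = - 'd (sq F) p v)].

Definition projectively_flat (U : set V) (F : TV -> R) : Prop :=
  exists P : TV -> R, homogeneous1 U P /\
    is_geodesic_spray U F (fun p => S0 p - (2 * P p) *: liouville p).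

(* Inversion is total with 0^-1 = 0, so that this is 0 at y = 0, where F = 0. *)
Definition projective_factor (F : TV -> R) (p : TV) : R :=
  act S0 F p / (2 * F p).

Definition Ncoef (G : TV -> V) (i j : 'I_n) : TV -> R :=
  d_dy j (fun p => G p 0 i).

Definition delta_dx (G : TV -> V) (i : 'I_n) (f : TV -> R) : TV -> R :=
  fun p => d_dx i f p - \sum_(j < n) Ncoef G j i p * d_dy j f p.

Definition Rcoef (G : TV -> V) (i j : 'I_n) : TV -> R := fun p =>
  2 * delta_dx G j (fun q => G q 0 i) p - act (spray G) (Ncoef G i j) p
  + \sum_(k < n) Ncoef G i k p * Ncoef G k j p.

(* Phi = R^i_j d/dy^i (x) dx^j, as an endomorphism of tangent vectors. *)
Definition Phi (G : TV -> V) (p v : TV) : TV :=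
  (0, \row_(i < n) \sum_(j < n) Rcoef G i j p * v.1 0 j).

Definition constant_flag_curvature (U : set V) (F : TV -> R) (kappa : R) : Prop :=
  exists G : TV -> V, is_geodesic_spray U F (spray G) /\
    forall p v, slit_tangent U p ->
      Phi G p v = (kappa * F p ^+ 2) *: Jmap v
                  - (kappa * F p * dJ F p v) *: liouville p.

Definition zero_flag_curvature (U : set V) (F : TV -> R) : Prop :=
  constant_flag_curvature U F 0.

(* F = alpha + beta, with alpha the norm of a Riemannian metric a on U and beta
   a 1-form on U whose norm with respect to a is less than 1. *)
Definition randers_metric (U : set V) (F : TV -> R) : Prop :=
  exists (a : V -> 'M[R]_n) (b : V -> V),
    [/\ smooth_on U a, smooth_on U b,
        (forall x, U x -> (a x)^T = a x /\
           forall y : V, y != 0 -> 0 < (y *m a x *m y^T) 0 0),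
        (forall x, U x -> Num.sqrt ((b x *m invmx (a x) *m (b x)^T) 0 0) < 1) &
        (forall x y, U x ->
           F (x, y) = Num.sqrt ((y *m a x *m y^T) 0 0) + dotp (b x) y)].

End Finsler.

Section Metrics.
Context {R : realType} {n : nat}.

Definition rootc (c : R) (x y : 'rV[R]_n) : R :=
  Num.sqrt (enorm y ^+ 2
            - 4 * c ^+ 2 * (enorm x ^+ 2 * enorm y ^+ 2 - dotp x y ^+ 2)).

Definition randersF (c : R) (p : 'rV[R]_n * 'rV[R]_n) : R :=
  let: (x, y) := p in
  rootc c x y / (1 - 4 * c ^+ 2 * enorm x ^+ 2)
  + 2 * c * dotp x y / (1 - 4 * c ^+ 2 * enorm x ^+ 2).

(* At y = 0 the value is 0, as 0^-1 = 0. *)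
Definition Fbar (c eta : R) (p : 'rV[R]_n * 'rV[R]_n) : R :=
  let: (x, y) := p in
  eta * (rootc c x y + 2 * c * dotp x y) ^+ 2
  / ((1 - 4 * c ^+ 2 * enorm x ^+ 2) ^+ 2 * rootc c x y).

End Metrics.

(* Main.v *)
Require Import Defs.
From HB Require Import structures.
From mathcomp Require Import all_boot all_order all_algebra.
From mathcomp Require Import all_classical all_reals all_analysis.
From mathcomp Require Import ring lra.

Set Implicit Arguments.
Unset Strict Implicit.
Unset Printing Implicit Defensive.

Import Order.TTheory GRing.Theory Num.Theory.
Import numFieldNormedType.Exports.

Local Open Scope classical_set_scope.
Local Open Scope ring_scope.

(** Write <x,y> for the Euclidean product, lam = 1 - 4c^2|x|^2,
    beta = 2c<x,y> and alpha for the square root in both metrics, so that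
    alpha^2 = lam |y|^2 + beta^2, F = (alpha + beta) / lam and
    Fbar = eta F^2 / alpha.  Up to the dilation x -> 2cx, F is the Funk metric
    of the unit ball, and everything follows from its differential equation
    [funk_randers]

      F_(x^k) = 2c F F_(y^k).

    It says that F_(x^k) = (P F)_(y^k) with P = cF, and it implies
    [derive_x_alpha], from which Fbar_(x^k) = (P Fbar)_(y^k) with P = 2cF
    ([flat_Fbar]).  By Rapcsak's criterion [geodesic_spray], a 1-homogeneous F
    with F_(x^k) = (P F)_(y^k), P being 1-homogeneous, has the geodesic spray
    S0 - 2P C; the proof only exchanges derivatives along S0 and C with constant
    directions and applies Euler's identity.  Hence both metrics are
    projectively flat, and contracting with y shows that the projective factor
    of Fbar is 2cF.  This P = 2cF satisfies in turn P_(x^k) = P P_(y^k), and for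
    such a P the curvature of the spray S0 - 2P C vanishes identically
    ([Rcoef0]).

    The fundamental tensor is nondegenerate because F > 0 is convex on each
    fibre, flat only in the radial direction ([rank_fundamental]).  On a fibre,
    alpha is the norm of the inner product a = lam <,> + beta (x) beta; its
    Hessian d2alpha is given by Cauchy-Schwarz for a ([d2alphaE]), and with
    s = beta / alpha, |s| < 1,

      (alpha + beta)'' = alpha'',
      ((alpha + beta)^2 / alpha)''
        = (1 - s^2) alpha'' + (2 / alpha) (beta' - s alpha')^2

    ([derive2_randers], [derive2_Fbar]).  Smoothness is obtained by checking that
    the functions of class C^k are closed under the operations which build the
    two metrics. *)

(** * Derivatives along lines and differentiation rules *)

Section Lines.
Context {R : realType} {V W : normedModType R}.

(** Reduces directional derivatives to derivatives of functions of one real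
    variable, where the chain rule and the mean value theorem are available. *)
Lemma is_derive_line (f : V -> W) (p v : V) (t : R) (df : W) :
  is_derive (t *: v + p) v f df <->
  is_derive t 1 (fun s => f (s *: v + p)) df.
Proof.
have E : (fun h : R => h^-1 *: ((f \o shift (t *: v + p)) (h *: v)
                                 - f (t *: v + p)))
   = (fun h : R => h^-1 *: (((fun s => f (s *: v + p)) \o shift t) (h *: 1)
        - (fun s => f (s *: v + p)) t)).
  by apply/funext => h /=; rewrite [h%:A]mulr1 scalerDl addrA.
by split=> -[d e]; split; move: d e; rewrite /derivable /derive E.
Qed.

End Lines.

Section DerivativeRules.
Context {R : realType} {V : normedModType R}.
Implicit Types (f g : V -> R) (p v : V).

(** The rules of this section are stated for lambda-expressions, so that the
    derivative of an explicit formula is obtained by composing them. *)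
Lemma is_derive_add f g p v df dg : is_derive p v f df -> is_derive p v g dg ->
  is_derive p v (fun q => f q + g q) (df + dg).
Proof. by move=> fd gd; exact: (is_deriveD fd gd). Qed.

Lemma is_derive_mul f g p v df dg : is_derive p v f df -> is_derive p v g dg ->
  is_derive p v (fun q => f q * g q) (df * g p + f p * dg).
Proof.
move=> fd gd; apply: is_derive_eq (is_deriveM fd gd) _.
by rewrite addrC mulrC.
Qed.

Lemma is_derive_const (a : R) p v : is_derive p v (fun=> a) 0.
Proof. exact: is_derive_cst. Qed.

Lemma is_derive_inv f p v df : f p != 0 -> is_derive p v f df ->
  is_derive p v (fun q => (f q)^-1) (- df / f p ^+ 2).
Proof.
move=> f0 [fd fE]; split; first exact: derivableV.
by rewrite [LHS]deriveV // fE -[LHS]/(- f p ^- 2 * df) !mulNr mulrC.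
Qed.

End DerivativeRules.

(** * Functions of class C^k *)

Section SmoothCalculus.
Context {R : realType} {V : normedModType R}.

(** The difference of the two functions vanishes near p, hence has the zero
    differential there. *)
Lemma near_eq_differentiable (W : normedModType R) (f g : V -> W) (p : V) :
  (\near p, f p = g p) -> differentiable f p -> differentiable g p.
Proof.
move=> fg df.
suff dh : differentiable (g - f) p.
  have -> : g = f + (g - f) by apply/funext => q; rewrite /= !fctE addrC subrK.
  exact: differentiableD.
have hE : (g - f) \o shift p = cst ((g - f) p) + (\0 : V -> W) +o_ 0 id.
  apply/eqaddoP => _/posnumP[e].
  near=> h; rewrite /= !fctE (nbhs_singleton fg) subrr.
  rewrite (_ : g (h + p) = f (h + p)) ?subrr ?addr0 ?subrr ?normr0 ?mulr_ge0//.
  by apply/esym; near: h; move: fg; rewrite (near_shift 0) subr0.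
apply/diff_locallyP.
have c0 : continuous (\0 : V -> W) by move=> x; exact: cvg_cst.
have E : 'd (g - f) p = (\0 : {linear V -> W}) :> (V -> W).
  exact: diff_unique.
by rewrite E.
Unshelve. all: by end_near. Qed.

(** [Ck_on] quantifies over derivatives of total functions, while the product
    and chain rules hold on A only; openness of A makes the two agree. *)
Lemma Ck_ext (W : normedModType R) (A : set V) (f g : V -> W) k : open A ->
  (forall p, A p -> f p = g p) -> Ck_on k A f -> Ck_on k A g.
Proof.
move=> oA; elim: k f g => [|k IH] f g fg /=.
  move=> fc p pA; have Ap : A p by rewrite inE in pA.
  rewrite /continuous_at -(fg _ Ap); apply: cvg_trans (fc p pA).
  by apply: near_eq_cvg; near=> q; apply: fg; near: q; exact: open_nbhs_nbhs.
have nfg p : A p -> \near p, f p = g p.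
  by move=> Ap; near=> q; apply: fg; near: q; exact: open_nbhs_nbhs.
move=> [df Df]; split=> [p Ap|v].
  exact: near_eq_differentiable (nfg p Ap) (df p Ap).
by apply: IH (Df v) => p Ap; apply: near_eq_derive; exact: nfg.
Unshelve. all: by end_near. Qed.

Lemma CkW (W : normedModType R) (A : set V) (f : V -> W) k :
  Ck_on k.+1 A f -> Ck_on k A f.
Proof.
elim: k f => [|k IH] f [df Df].
  move=> p pA; apply: differentiable_continuous; apply: df.
  by rewrite inE in pA.
by split=> // v; apply: IH.
Qed.

Lemma Ck_cst (W : normedModType R) (A : set V) (w : W) k :
  Ck_on k A (fun=> w).
Proof.
elim: k w => [|k IH] w /=; first by move=> p _; exact: cvg_cst.
split=> [p _|v]; first exact: differentiable_cst.
by rewrite (_ : 'D_v _ = fun=> 0) //; apply/funext => p; rewrite derive_cst.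
Qed.

Lemma CkD (W : normedModType R) (A : set V) (f g : V -> W) k : open A ->
  Ck_on k A f -> Ck_on k A g -> Ck_on k A (fun p => f p + g p).
Proof.
move=> oA; elim: k f g => [|k IH] f g.
  by move=> fc gc p pA; exact: (cvgD (fc p pA) (gc p pA)).
move=> [df Df] [dg Dg]; split=> [p Ap|v].
  exact: (differentiableD (df p Ap) (dg p Ap)).
apply: Ck_ext (IH _ _ (Df v) (Dg v)) => // p Ap; rewrite -deriveD //.
all: by apply: diff_derivable; auto.
Qed.

(** By induction on k: the Leibniz rule writes a derivative of the product with
    products of functions that are one degree less regular. *)
Lemma CkM (A : set V) (f g : V -> R) k : open A ->
  Ck_on k A f -> Ck_on k A g -> Ck_on k A (fun p => f p * g p).
Proof.
move=> oA; elim: k f g => [|k IH] f g.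
  by move=> fc gc p pA; exact: (cvgM (fc p pA) (gc p pA)).
move=> Cf Cg; have [[df Df] [dg Dg]] := (Cf, Cg); split=> [p Ap|v].
  exact: (differentiableM (df p Ap) (dg p Ap)).
apply: Ck_ext (CkD oA (IH _ _ (CkW Cf) (Dg v)) (IH _ _ (CkW Cg) (Df v))) => //.
move=> p Ap; rewrite -[_ + _]/(f p *: 'D_v g p + g p *: 'D_v f p) -deriveM //.
all: by apply: diff_derivable; auto.
Qed.

(** Together with [Ck_sum] this covers vector-valued functions, written as
    combinations of constant vectors with smooth coefficients. *)
Lemma CkZl (W : normedModType R) (A : set V) (f : V -> R) (w : W) k :
  open A -> Ck_on k A f -> Ck_on k A (fun p => f p *: w).
Proof.
move=> oA; elim: k f => [|k IH] f.
  by move=> fc p pA; exact: (cvgZr_tmp (fc p pA)).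
move=> [df Df]; split=> [p Ap|v].
  exact: differentiableZl (df p Ap).
apply: Ck_ext (IH _ (Df v)) => // p Ap.
rewrite (deriveE _ (differentiableZl w (df p Ap))) (diffZl w (df p Ap)) /=.
by rewrite -deriveE //; exact: df.
Qed.

Lemma Ck_sum (W : normedModType R) (A : set V) (I : Type) (r : seq I)
    (f : I -> V -> W) k : open A ->
  (forall i, Ck_on k A (f i)) -> Ck_on k A (fun p => \sum_(i <- r) f i p).
Proof.
move=> oA Cf; elim: r => [|i r IH].
  rewrite (_ : (fun p => _) = fun=> 0); first exact: Ck_cst.
  by apply/funext => p; rewrite big_nil.
rewrite (_ : (fun p => _) = fun p => f i p + \sum_(i <- r) f i p).
  exact: CkD.
by apply/funext => p; rewrite big_cons.
Qed.

(** The derivative of 1/f is - (1/f)^2 f', a product to which the induction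
    hypothesis on k applies. *)
Lemma CkV (A : set V) (f : V -> R) k : open A ->
  (forall p, A p -> f p != 0) -> Ck_on k A f -> Ck_on k A (fun p => (f p)^-1).
Proof.
move=> oA f0; elim: k => [|k IH] Cf.
  by move=> p pA; apply: (cvgV _ (Cf p pA)); apply: f0; rewrite inE in pA.
have [df Df] := Cf; split=> [p Ap|v].
  exact: (differentiableV (df p Ap) (f0 p Ap)).
have Cg := IH (CkW Cf).
apply: Ck_ext (CkM oA (Ck_cst A (-1 : R) k) (CkM oA (CkM oA Cg Cg) (Df v))) => //.
move=> p Ap; rewrite [RHS]deriveV; [|exact: f0|exact/diff_derivable/df].
by rewrite -[RHS]/(- (f p) ^- 2 * 'D_v f p) mulN1r mulNr -invfM -expr2.
Qed.

Lemma is_derive_sqrt (f : V -> R) (p v : V) (df : R) : 0 < f p ->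
  is_derive p v f df ->
  is_derive p v (fun q => Num.sqrt (f q)) (df / (2 * Num.sqrt (f p))).
Proof.
move=> fp0 fd.
have L (g : V -> R) dg : is_derive p v g dg <->
    is_derive (0 : R) 1 (fun s => g (s *: v + p)) dg.
  by rewrite -is_derive_line scale0r add0r.
move/L in fd; apply/L.
have f0 : 0 < f (0 *: v + p) by rewrite scale0r add0r.
have := @is_derive1_comp _ Num.sqrt (fun s : R => f (s *: v + p)) 0 _ _
  (is_derive1_sqrt f0) fd.
by rewrite scale0r add0r mulrC.
Qed.

(** As in [CkV], the square root reappears in its own derivative. *)
Lemma Ck_sqrt (A : set V) (f : V -> R) k : open A ->
  (forall p, A p -> 0 < f p) -> Ck_on k A f ->
  Ck_on k A (fun p => Num.sqrt (f p)).
Proof.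
move=> oA f0; elim: k => [|k IH] Cf.
  move=> p pA; apply: (@continuous_comp _ _ _ f (@Num.sqrt R)).
    exact: Cf.
  exact: sqrt_continuous.
have [df Df] := Cf; split=> [p Ap|v].
  apply: (differentiable_comp (df p Ap)); apply/derivable1_diffP.
  exact/ex_derive/is_derive1_sqrt/f0.
have s0 p : A p -> 2 * Num.sqrt (f p) != 0.
  by move=> /f0 fp; rewrite mulf_neq0 ?gt_eqF ?sqrtr_gt0.
have Cs := CkV oA s0 (CkM oA (Ck_cst A (2 : R) k) (IH (CkW Cf))).
apply: Ck_ext (CkM oA (Df v) Cs) => // p Ap.
apply/esym/derive_val/is_derive_sqrt; first exact: f0.
exact/derivableP/diff_derivable/df.
Qed.

Section Linear.
Variables (W : normedModType R) (f : V -> W).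
Hypotheses (lf : linear f) (fc : continuous f).
Let F : {linear V -> W} := HB.pack f (GRing.isLinear.Build _ _ _ _ _ lf).

Lemma is_derive_linear (p v : V) : is_derive p v f (f v).
Proof.
have df : differentiable F p by exact: linear_differentiable.
split; first exact: (@diff_derivable _ _ _ F p v df).
by rewrite (deriveE v df) (diff_lin (f := F)).
Qed.

Lemma Ck_linear (A : set V) k : Ck_on k A f.
Proof.
case: k => [p _|k]; first exact: fc.
split=> [p _|v]; first exact: (linear_differentiable (f := F)).
rewrite (_ : 'D_v f = fun=> f v); first exact: Ck_cst.
by apply/funext => p; case: (is_derive_linear p v).
Qed.

End Linear.

End SmoothCalculus.

(** * Symmetry of second derivatives *)

Section Schwarz.
Context {R : realType} {V : normedModType R}.

Lemma MVT_line (f : V -> R) (p v : V) (h : R) : 0 < h ->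
  (forall t, 0 <= t <= h -> derivable f (t *: v + p) v) ->
  exists2 t, 0 <= t <= h & f (h *: v + p) - f p = 'D_v f (t *: v + p) * h.
Proof.
move=> h0 df.
have dl t : t \in `[0, h] ->
    is_derive t 1 (fun s => f (s *: v + p)) ('D_v f (t *: v + p)).
  rewrite in_itv /= => /df dt.
  exact: (is_derive_line f p v t _).1 (derivableP dt).
have cf : {within `[0, h], continuous (fun s => f (s *: v + p))}.
  by apply: derivable_within_continuous => s /dl [].
have dlo t : t \in `]0, h[ ->
    is_derive t 1 (fun s => f (s *: v + p)) ('D_v f (t *: v + p)).
  by move=> /subset_itv_oo_cc /dl.
have [t ht] := MVT h0 dlo cf.
rewrite /= subr0 scale0r add0r => ->; exists t => //.
by have /subset_itv_oo_cc := ht; rewrite in_itv.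
Qed.

Lemma is_derive_translate (W : normedModType R) (f : V -> W) (w p v : V) df :
  is_derive (w + p) v f df -> is_derive p v (fun q => f (w + q)) df.
Proof.
have E : (fun h : R => h^-1 *: ((f \o shift (w + p)) (h *: v) - f (w + p)))
  = (fun h : R => h^-1 *: (((fun q => f (w + q)) \o shift p) (h *: v)
        - (fun q => f (w + q)) p)).
  by apply/funext => h /=; rewrite addrCA.
by move=> -[d e]; split; move: d e; rewrite /derivable /derive E.
Qed.

(** Two applications of the mean value theorem, first in the direction u to the
    increment of f by h v, then in the direction v to the derivative of f along
    u.  The set B localizes the intermediate point near p. *)
Lemma second_difference (A B : set V) (f : V -> R) (p u v : V) :
  open A -> Ck_on 2 A f -> A p -> nbhs p B ->
  exists2 d : R, 0 < d & forall h, 0 < h < d -> exists2 q, B q &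
    f (h *: u + (h *: v + p)) - f (h *: u + p) - (f (h *: v + p) - f p)
    = 'D_v ('D_u f) q * h * h.
Proof.
move=> oA [df Df] Ap Bp.
have /nbhs_ballP[r /= r0 rAB] : nbhs p (A `&` B).
  by apply: filterI => //; exact: open_nbhs_nbhs.
have N0 : 0 < `|u| + `|v| + 1 by rewrite ltr_wpDl // addr_ge0.
(* The parallelogram spanned by h u and h v then lies in the ball of radius r;
   the summand 1 covers u = v = 0. *)
exists (r / (`|u| + `|v| + 1)); first exact: divr_gt0.
move=> h /andP[h0]; rewrite ltr_pdivlMr // => hr.
have inAB s t : 0 <= s <= h -> 0 <= t <= h -> (A `&` B) (s *: u + (t *: v + p)).
  move=> /andP[s0 sh] /andP[t0 th]; apply: rAB.
  rewrite -ball_normE /= addrA opprD addrCA subrr addr0 normrN.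
  apply: le_lt_trans hr; rewrite (le_trans (ler_normD _ _)) // !normrZ.
  rewrite !ger0_norm // mulrDr mulr1 mulrDr -addrA lerD ?ler_wpM2r //.
  by rewrite (le_trans (ler_wpM2r _ th)) // lerDl ltW.
have hh : 0 <= h <= h by rewrite lexx ltW.
have z0 : (0 : R) <= 0 <= h by apply/andP; split; [exact: lexx|exact: ltW].
pose g q := f (h *: v + q) - f q.
have Ain s t : 0 <= s <= h -> 0 <= t <= h -> A (s *: u + (t *: v + p)).
  by move=> hs ht; case: (inAB s t hs ht).
have dg s : 0 <= s <= h -> is_derive (s *: u + p) u g
    ('D_u f (s *: u + (h *: v + p)) - 'D_u f (s *: u + p)).
  move=> hs; apply: is_deriveB.
    rewrite addrCA; apply: is_derive_translate; rewrite addrCA.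
    by apply: derivableP; apply: diff_derivable; apply/df/Ain.
  apply: derivableP; apply: diff_derivable; apply: df.
  by have := Ain s 0 hs z0; rewrite scale0r add0r.
have [|s hs] := @MVT_line g p u h h0.
  by move=> s /dg [].
rewrite /g (addrCA (h *: v)) => ->; have [_ ->] := dg s hs.
have [|t ht] := @MVT_line ('D_u f) (s *: u + p) v h h0.
  move=> t ht; apply: diff_derivable; have [+ _] := Df u; apply.
  by rewrite addrCA; exact: Ain.
rewrite !(addrCA _ (s *: u)) => ->; exists (s *: u + (t *: v + p)) => //.
by case: (inAB s t hs ht).
Qed.

Lemma dist_lt_halves (a b m e : R) :
  `|a - m| < e / 2 -> `|b - m| < e / 2 -> `|a - b| <= e.
Proof.
move=> am bm; rewrite [e]splitr -(subrKA m) (le_trans (ler_normD _ _)) //.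
by apply: lerD; apply: ltW => //; rewrite distrC.
Qed.

(** The second difference of f is symmetric in u and v, so by
    [second_difference] both mixed derivatives take a common value at points
    arbitrarily near p; they are continuous there. *)
Lemma schwarz (A : set V) (f : V -> R) (p u v : V) :
  open A -> Ck_on 2 A f -> A p -> 'D_u ('D_v f) p = 'D_v ('D_u f) p.
Proof.
move=> oA C2 Ap; have [df Df] := C2.
have c (a b : V) : {for p, continuous ('D_a ('D_b f))}.
  by have [_ /(_ a)] := Df b; apply; rewrite inE.
apply/eqP; rewrite -subr_eq0 -normr_le0; apply/ler_addgt0Pl => e e0.
rewrite addr0.
have near_p (a b : V) : \forall q \near p,
    `|'D_a ('D_b f) p - 'D_a ('D_b f) q| < e / 2.
  have /cvgr_dist_lt := c a b; apply; exact: divr_gt0.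
have [d1 d10 H1] := second_difference u v oA C2 Ap (near_p v u).
have [d2 d20 H2] := second_difference v u oA C2 Ap (near_p u v).
pose h := Num.min d1 d2 / 2.
have m0 : 0 < Num.min d1 d2 by rewrite lt_min d10.
have h0 : 0 < h by exact: divr_gt0.
have hm : h < Num.min d1 d2 by rewrite ltr_pdivrMr // ltr_pMr // ltr1n.
move: (hm); rewrite lt_min => /andP[hd1 hd2].
have [|q1 Bq1 E1] := H1 h; first by rewrite h0.
have [|q2 Bq2 E2] := H2 h; first by rewrite h0.
have E : 'D_v ('D_u f) q1 = 'D_u ('D_v f) q2.
  apply: (mulIf (lt0r_neq0 h0)); apply: (mulIf (lt0r_neq0 h0)).
  apply: (etrans (esym E1)); apply: etrans E2.
  have -> : h *: v + (h *: u + p) = h *: u + (h *: v + p) by rewrite addrCA.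
  by move: (f _) (f _) (f _) (f _) => f3 f1 f2 f0; ring.
rewrite -E in Bq2; exact: dist_lt_halves Bq2 Bq1.
Qed.

End Schwarz.

(** * Calculus on the tangent bundle *)

Section TangentBundle.
Context {R : realType} {n : nat}.
Notation V := 'rV[R]_n.
Notation TV := ('rV[R]_n * 'rV[R]_n)%type.
Implicit Types (U : set V) (A : set TV) (p q v : TV) (F P : TV -> R).

Lemma open_slit_tangent U : open U -> open (slit_tangent U).
Proof.
move=> oU.
have -> : slit_tangent U = fst @^-1` U `&` snd @^-1` ~` [set 0].
  by apply/seteqP; split=> p [Up /= /eqP].
apply: openI; apply: open_comp => //.
- by move=> p _; exact: cvg_fst.
- by move=> p _; exact: cvg_snd.
- rewrite openC; apply: accessible_closed_set1.
  exact: hausdorff_accessible (@norm_hausdorff _ _).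
Qed.

Let coord1 (i : 'I_n) : TV -> R := fun p => p.1 0 i.
Let coord2 (i : 'I_n) : TV -> R := fun p => p.2 0 i.

Let coord1_linear i : linear (coord1 i).
Proof. by move=> a p q; rewrite /coord1 /= !mxE. Qed.

Let coord2_linear i : linear (coord2 i).
Proof. by move=> a p q; rewrite /coord2 /= !mxE. Qed.

Let coord1_continuous i : continuous (coord1 i).
Proof.
move=> p; apply: (@continuous_comp _ _ _ fst (fun x : V => x 0 i)).
  exact: cvg_fst.
exact: coord_continuous.
Qed.

Let coord2_continuous i : continuous (coord2 i).
Proof.
move=> p; apply: (@continuous_comp _ _ _ snd (fun x : V => x 0 i)).
  exact: cvg_snd.
exact: coord_continuous.
Qed.

Lemma is_derive_coord1 i p v : is_derive p v (fun q => q.1 0 i) (v.1 0 i).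
Proof. exact: is_derive_linear (@coord1_linear i) (@coord1_continuous i) p v. Qed.

Lemma is_derive_coord2 i p v : is_derive p v (fun q => q.2 0 i) (v.2 0 i).
Proof. exact: is_derive_linear (@coord2_linear i) (@coord2_continuous i) p v. Qed.

Lemma Ck_coord1 A i k : Ck_on k A (fun q => q.1 0 i).
Proof. exact: Ck_linear (@coord1_linear i) (@coord1_continuous i) A k. Qed.

Lemma Ck_coord2 A i k : Ck_on k A (fun q => q.2 0 i).
Proof. exact: Ck_linear (@coord2_linear i) (@coord2_continuous i) A k. Qed.

Lemma derive_linear_dir F p (a : R) u v : differentiable F p ->
  'D_(a *: u + v) F p = a * 'D_u F p + 'D_v F p.
Proof. by move=> dF; rewrite !deriveE // linearP. Qed.

Lemma derive_sum_dir F p (a : 'I_n -> R) (e : 'I_n -> TV) : differentiable F p ->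
  'D_(\sum_i a i *: e i) F p = \sum_i a i * 'D_(e i) F p.
Proof.
move=> dF; rewrite deriveE // linear_sum; apply: eq_bigr => i _.
by rewrite linearZ deriveE.
Qed.

Lemma sum_ex (x : V) : \sum_i x 0 i *: ex i = (x, 0) :> TV.
Proof.
rewrite [in RHS](row_sum_delta x).
elim/big_rec2: _ => [//|i a b _ ->].
by congr pair; rewrite /= ?scaler0 ?addr0.
Qed.

Lemma sum_ey (y : V) : \sum_i y 0 i *: ey i = (0, y) :> TV.
Proof.
rewrite [in RHS](row_sum_delta y).
elim/big_rec2: _ => [//|i a b _ ->].
by congr pair; rewrite /= ?scaler0 ?addr0.
Qed.

(** A product rule: the field L depends linearly on y, so its derivative in the
    direction v is L v.  The mixed second derivatives are exchanged by
    [schwarz].  With e = [ey] or [ex] the field L is the Liouville field or S0. *)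
Lemma derive_along A F (e : 'I_n -> TV) (L := fun q => \sum_i q.2 0 i *: e i) p v :
  open A -> Ck_on 2 A F -> A p ->
  'D_v (fun q => 'D_(L q) F q) p = 'D_(L v) F p + 'D_(L p) ('D_v F) p.
Proof.
move=> oA C2 Ap; have [dF DF] := C2.
have near_A : \near p, A p by exact: open_nbhs_nbhs.
have -> : 'D_v (fun q => 'D_(L q) F q) p
    = 'D_v (fun q => \sum_i q.2 0 i * 'D_(e i) F q) p.
  apply: near_eq_derive; near=> q; apply: derive_sum_dir; apply: dF.
  by near: q.
have dDF w : differentiable ('D_w F) p by have [+ _] := DF w; exact.
have d i : is_derive p v (fun q => q.2 0 i * 'D_(e i) F q)
    (p.2 0 i *: 'D_v ('D_(e i) F) p + 'D_(e i) F p *: v.2 0 i).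
  apply: is_deriveM; first exact: is_derive_coord2.
  exact/derivableP/diff_derivable.
rewrite derive_sum_dir; last exact: dF.
rewrite derive_sum_dir //.
rewrite (_ : (fun q => _) = \sum_i (fun q => q.2 0 i * 'D_(e i) F q)); last first.
  by apply/funext => q; rewrite fct_sumE.
rewrite derive_val -big_split; apply: eq_bigr => i _ /=.
rewrite (schwarz v (e i) oA C2 Ap) addrC; congr (_ + _); exact: mulrC.
Unshelve. all: by end_near. Qed.

(** Solving [derive_along] for the second derivative: when the derivative of F
    along the Liouville field is known (by Euler's identity), so is that of every
    partial derivative of F. *)
Lemma derive_liouville A F p v : open A -> Ck_on 2 A F -> A p ->
  'D_(liouville p) ('D_v F) p
  = 'D_v (fun q => 'D_(liouville q) F q) p - 'D_(liouville v) F p.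
Proof.
have E q : liouville q = \sum_i q.2 0 i *: ey i by rewrite sum_ey.
rewrite (_ : (fun q => _) = fun q => 'D_(\sum_i q.2 0 i *: ey i) F q); last first.
  by apply/funext => q; rewrite E.
by move=> oA C2 Ap; rewrite !E (derive_along ey v oA C2 Ap) addrC addKr.
Qed.

Lemma derive_S0 A F p v : open A -> Ck_on 2 A F -> A p ->
  'D_(S0 p) ('D_v F) p
  = 'D_v (fun q => 'D_(S0 q) F q) p - 'D_(S0 v) F p.
Proof.
have E q : S0 q = \sum_i q.2 0 i *: ex i by rewrite sum_ex.
rewrite (_ : (fun q => _) = fun q => 'D_(\sum_i q.2 0 i *: ex i) F q); last first.
  by apply/funext => q; rewrite E.
by move=> oA C2 Ap; rewrite !E (derive_along ex v oA C2 Ap) addrC addKr.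
Qed.

(** Differentiation of F(x, (1 + s) y) = (1 + s) F(x, y) at s = 0. *)
Lemma euler U F p : homogeneous1 U F -> U p.1 -> differentiable F p ->
  'D_(liouville p) F p = F p.
Proof.
move=> hF Up dF.
have := derivableP (diff_derivable (v := liouville p) dF).
rewrite -{1}[p]add0r -{1}(scale0r (liouville p)) => /is_derive_line d1.
have d2 : is_derive (0 : R) 1 (fun s : R => (s + 1) * F p) (F p).
  apply: is_derive_eq (is_derive_mul (is_derive_add
    (is_derive_id _ _) (is_derive_const _ _ _)) (is_derive_const _ _ _)) _.
  by rewrite addr0 mul1r mulr0 addr0.
have nE : \forall s \near (0 : R), F (s *: liouville p + p) = (s + 1) * F p.
  near=> s.
  have s0 : 0 < s + 1.
    rewrite -ltrBlDr sub0r; near: s; apply: lt_nbhsr; by rewrite oppr_lt0.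
  case: p Up {d1 d2 dF} s0 => x y /= Ux s0; rewrite -hF //.
  by congr F; congr pair; rewrite /= ?scaler0 ?add0r // scalerDl scale1r.
have [_ <-] := d1; have [_ <-] := d2.
exact: near_eq_derive.
Unshelve. all: by end_near. Qed.

End TangentBundle.

(** * The geodesic spray of a projectively flat metric *)

Section Spray.
Context {R : realType} {n : nat}.
Notation V := 'rV[R]_n.
Notation TV := ('rV[R]_n * 'rV[R]_n)%type.
Variables (U : set V) (F P : TV -> R).
Hypotheses (oU : open U) (sF : smooth_on (slit_tangent U) F)
  (sP : smooth_on (slit_tangent U) P)
  (hF : homogeneous1 U F) (hP : homogeneous1 U P).
Let A := slit_tangent U.
Let E := sq F.
Let oA : open A := open_slit_tangent oU.

Let near_A p : A p -> \near p, A p.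
Proof. by move=> Ap; exact: open_nbhs_nbhs. Qed.

Lemma smooth_sq : smooth_on A E.
Proof.
move=> k; rewrite (_ : E = fun q => F q * F q); first exact: CkM.
by apply/funext => q; rewrite /E /sq expr2.
Qed.

Lemma Ck_differentiable (G : TV -> R) k p :
  Ck_on k.+1 A G -> A p -> differentiable G p.
Proof. by move=> [dG _]; exact: dG. Qed.

Lemma smooth_is_derive (G : TV -> R) p v :
  smooth_on A G -> A p -> is_derive p v G ('D_v G p).
Proof.
by move=> /(_ 1) C1 Ap; apply/derivableP/diff_derivable/(Ck_differentiable C1).
Qed.

Lemma derive_sq p v : A p -> 'D_v E p = 2 * F p * 'D_v F p.
Proof.
move=> Ap; have dF := smooth_is_derive v sF Ap.
have [_] := is_derive_mul dF dF.
rewrite (_ : (fun q => _) = E); last by apply/funext => q; rewrite /E /sq expr2.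
by move=> ->; ring.
Qed.

Lemma derive_mulPF p v : A p ->
  'D_v (fun q => P q * F q) p = 'D_v P p * F p + P p * 'D_v F p.
Proof.
move=> Ap; have dF := smooth_is_derive v sF Ap.
by have dP := smooth_is_derive v sP Ap; case: (is_derive_mul dP dF).
Qed.

Lemma derive_near_eq (f g : TV -> R) p v :
  (forall q, A q -> f q = g q) -> A p -> 'D_v f p = 'D_v g p.
Proof.
move=> fg Ap; apply: near_eq_derive; near=> q; apply: fg.
by near: q; exact: near_A.
Unshelve. all: by end_near. Qed.

Lemma euler_slit (G : TV -> R) p : homogeneous1 U G -> smooth_on A G -> A p ->
  'D_(liouville p) G p = G p.
Proof.
move=> hG sG Ap; apply: euler hG _ _; first by case: Ap.
exact: (Ck_differentiable (sG 1%N) Ap).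
Qed.

Lemma liouville_sq p : A p -> 'D_(liouville p) E p = 2 * E p.
Proof. by move=> Ap; rewrite derive_sq // euler_slit // /E /sq; ring. Qed.

Lemma dJE p v : A p -> dJ E p v = 'D_(Jmap v) E p.
Proof.
move=> Ap; rewrite /Jmap -sum_ey derive_sum_dir.
  by apply: eq_bigr => i _; rewrite mulrC.
exact: (Ck_differentiable (smooth_sq 1%N) Ap).
Qed.

Lemma differentiable_dJ p v : A p -> differentiable (fun q => dJ E q v) p.
Proof.
apply: (@Ck_differentiable _ 0%N); apply: Ck_sum => // i.
apply: CkM; [exact: oA| |exact: Ck_cst].
by have [_] := smooth_sq 2%N; apply.
Qed.

(** The first summand of the exterior derivative is a second derivative of F^2
    because d_J F^2 (v) is the derivative of F^2 along the constant vector Jv. *)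
Lemma ext_d_dJ p u v : A p -> ext_d (dJ E) p u v
  = 'D_u ('D_(Jmap v) E) p - 'D_v ('D_(Jmap u) E) p.
Proof.
move=> Ap; rewrite /ext_d -!deriveE; try exact: differentiable_dJ.
by congr (_ - _); apply: derive_near_eq => // q Aq; exact: dJE.
Qed.

Hypothesis flat : forall p (u : V), A p ->
  'D_((u, 0) : TV) F p = 'D_((0, u) : TV) (fun q => P q * F q) p.

(** Contraction of the hypothesis with y, followed by Euler's identity for the
    2-homogeneous function P F. *)
Lemma S0_sq p : A p -> 'D_(S0 p) E p = 4 * P p * E p.
Proof.
move=> Ap; rewrite derive_sq // flat // -/(liouville p) derive_mulPF //.
by rewrite !euler_slit // /E /sq; ring.
Qed.

Lemma derive_liouville_sq p w : A p ->
  'D_(liouville p) ('D_w E) p = 2 * 'D_w E p - 'D_(liouville w) E p.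
Proof.
move=> Ap; rewrite (derive_liouville _ oA (smooth_sq 2%N) Ap); congr (_ - _).
rewrite (derive_near_eq (g := fun q => 2 * E q)) //; last exact: liouville_sq.
have dE := smooth_is_derive w smooth_sq Ap.
by case: (is_derive_mul (is_derive_const 2 p w) dE) => _ ->; rewrite mul0r add0r.
Qed.

Lemma derive_S0_sq p w : A p -> 'D_(S0 p) ('D_w E) p
  = 4 * ('D_w P p * E p + P p * 'D_w E p) - 'D_(S0 w) E p.
Proof.
move=> Ap; rewrite (derive_S0 _ oA (smooth_sq 2%N) Ap); congr (_ - _).
rewrite (derive_near_eq (g := fun q => 4 * (P q * E q))) //; last first.
  by move=> q Aq; rewrite S0_sq // mulrA.
have dE := smooth_is_derive w smooth_sq Ap.
have dP := smooth_is_derive w sP Ap.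
case: (is_derive_mul (is_derive_const 4 p w) (is_derive_mul dP dE)) => _ ->.
by rewrite mul0r add0r.
Qed.

(** After [derive_S0_sq] and [derive_liouville_sq] only first derivatives of F
    and P remain, and the equation becomes polynomial in them: the derivatives
    along (v.1, 0) are eliminated with the hypothesis, and those along (0, v.2)
    cancel. *)
Lemma geodesic_equation p v : A p ->
  ext_d (dJ E) p (S0 p - (2 * P p) *: liouville p) v = - 'd E p v.
Proof.
move=> Ap; have C2 := smooth_sq 2%N.
have dE := Ck_differentiable (smooth_sq 1%N) Ap.
have dDE w : differentiable ('D_w E) p.
  by apply: (@Ck_differentiable _ 0%N) => //; have [_] := C2; apply.
rewrite ext_d_dJ // -[S0 p - _]addrC -scaleNr derive_linear_dir //.
rewrite (_ : Jmap (_ + _) = liouville p); last first.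
  by rewrite /Jmap /liouville /S0 /= scaler0 add0r.
rewrite (schwarz v (liouville p) oA C2 Ap).
rewrite (derive_S0_sq (Jmap v)) // (derive_liouville_sq (Jmap v)) //.
rewrite (derive_liouville_sq v) // -(deriveE v dE).
have -> : 'D_v E p = 'D_(S0 (Jmap v)) E p + 'D_(liouville v) E p.
  rewrite -['D_(S0 _) E p]mul1r -derive_linear_dir //; congr ('D__ E p).
  by rewrite scale1r [LHS]surjective_pairing; congr pair; rewrite /= ?add0r ?addr0.
rewrite -/(Jmap v) (derive_sq (Jmap v)) // (derive_sq (S0 _)) // flat //.
rewrite -/(Jmap v) derive_mulPF // /E /sq.
move: ('D_(Jmap v) F p) ('D_(Jmap v) P p) ('D_(liouville v) _ p) => a b d.
rewrite /sq; ring.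
Qed.

Lemma smooth_spray : smooth_on A (fun p => S0 p - (2 * P p) *: liouville p).
Proof.
move=> k.
rewrite (_ : (fun p => _) = fun p : TV => \sum_i p.2 0 i *: ex i
    + \sum_i (- (2 * P p) * p.2 0 i) *: ey i); last first.
  apply/funext => p; rewrite sum_ex; congr (_ + _).
  rewrite /liouville -sum_ey -scaleNr scaler_sumr; apply: eq_bigr => i _.
  by rewrite scalerA.
have c2 i : Ck_on k A (fun p : TV => p.2 0 i) by exact: Ck_coord2.
apply: CkD => //; apply: Ck_sum => // i; apply: CkZl => //; apply: CkM => //.
rewrite (_ : (fun p => _) = fun p => -2 * P p).
  by apply: CkM => //; exact: Ck_cst.
by apply/funext => p; rewrite mulNr.
Qed.

(** Rapcsak's criterion for projective flatness. *)
Lemma geodesic_spray :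
  is_geodesic_spray U F (fun p => S0 p - (2 * P p) *: liouville p).
Proof.
split; first exact: smooth_spray.
  by move=> p _; rewrite /= scaler0 subr0.
by move=> p v Ap; exact: geodesic_equation.
Qed.

End Spray.

(** * The curvature of the spray S0 - 2P C *)

Section Curvature.
Context {R : realType} {n : nat}.
Notation V := 'rV[R]_n.
Notation TV := ('rV[R]_n * 'rV[R]_n)%type.
Variables (U : set V) (P : TV -> R).
Hypotheses (oU : open U) (sP : smooth_on (slit_tangent U) P)
  (hP : homogeneous1 U P).
Let A := slit_tangent U.
Let oA : open A := open_slit_tangent oU.
Hypothesis funk : forall p (u : V), A p ->
  'D_((u, 0) : TV) P p = P p * 'D_((0, u) : TV) P p.
Let G (p : TV) : V := P p *: p.2.

Let dP p v : A p -> is_derive p v P ('D_v P p).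
Proof. exact: smooth_is_derive. Qed.

Let dG p v i : A p -> is_derive p v (fun q => G q 0 i)
  ('D_v P p * p.2 0 i + P p * v.2 0 i).
Proof.
move=> Ap; rewrite (_ : (fun q => _) = fun q => P q * q.2 0 i).
  exact: is_derive_mul (dP v Ap) (is_derive_coord2 i p v).
by apply/funext => q; rewrite mxE.
Qed.

Let NE i j p : A p ->
  Ncoef G i j p = d_dy j P p * p.2 0 i + P p * (i == j)%:R.
Proof. by move=> /dG - /(_ (ey j) i) [_ /= E]; rewrite /Ncoef /d_dy E mxE. Qed.

Let derive_S0_P p v : A p -> 'D_(S0 p) ('D_v P) p
  = 2 * P p * 'D_v P p - 'D_(S0 v) P p.
Proof.
move=> Ap; rewrite (derive_S0 _ oA (sP 2%N) Ap); congr (_ - _).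
rewrite (derive_near_eq oU (g := fun q => P q * P q)) //; last first.
  by move=> q Aq; rewrite funk // -/(liouville q) (euler_slit hP sP Aq).
by have [_ ->] := is_derive_mul (dP v Ap) (dP v Ap); ring.
Qed.

Let derive_liouville_P p v : A p -> 'D_(liouville p) ('D_v P) p
  = 'D_v P p - 'D_(liouville v) P p.
Proof.
move=> Ap; rewrite (derive_liouville _ oA (sP 2%N) Ap); congr (_ - _).
by apply: (derive_near_eq oU) => // q Aq; exact: (euler_slit hP sP Aq).
Qed.

Let spray_lin p : spray G p = - (2 * P p) *: liouville p + S0 p.
Proof.
rewrite /spray /liouville /S0 /G [RHS]surjective_pairing.
by congr pair; rewrite /= ?scaler0 ?add0r // addr0 scalerA scaleNr.
Qed.

Let act_spray_P p : A p -> 'D_(spray G p) P p = - P p ^+ 2.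
Proof.
move=> Ap; rewrite spray_lin derive_linear_dir; last first.
  exact: (Ck_differentiable (sP 1%N) Ap).
by rewrite funk // -/(liouville p) (euler_slit hP sP Ap); ring.
Qed.

(** The spray is S0 - 2P C; the term along C vanishes as P_j is
    0-homogeneous. *)
Let act_spray_dP p j : A p -> 'D_(spray G p) (d_dy j P) p = P p * d_dy j P p.
Proof.
move=> Ap; rewrite spray_lin derive_linear_dir; last first.
  by apply: (@Ck_differentiable _ _ U _ 0%N) => //; have [_] := sP 2%N; apply.
rewrite derive_liouville_P // derive_S0_P // funk //.
rewrite -/(liouville (ey j)) /d_dy /=.
have -> : liouville (ey j) = ey j by [].
by move: ('D__ P p) => a; ring.
Qed.

Let sum_d_dy p : A p -> \sum_k p.2 0 k * d_dy k P p = P p.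
Proof.
move=> Ap; rewrite -[RHS](euler_slit hP sP Ap) /liouville -sum_ey.
rewrite derive_sum_dir //; exact: (Ck_differentiable (sP 1%N) Ap).
Qed.

Let sumNN i j p : A p -> \sum_k Ncoef G i k p * Ncoef G k j p
  = 3 * P p * d_dy j P p * p.2 0 i + P p ^+ 2 * (i == j)%:R.
Proof.
move=> Ap.
(* The four products, arranged so that the sums over k are Euler's identity
   and contractions with Kronecker symbols. *)
rewrite (eq_bigr (fun k => d_dy j P p * p.2 0 i * (p.2 0 k * d_dy k P p)
   + P p * p.2 0 i * (d_dy k P p * (k == j)%:R)
   + P p * d_dy j P p * (p.2 0 k * (i == k)%:R)
   + P p ^+ 2 * ((i == k)%:R * (k == j)%:R))); last first.
  by move=> k _; rewrite !NE //; ring.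
have pick (f : 'I_n -> R) l : \sum_k f k * (k == l)%:R = f l.
  rewrite (bigD1 l) //= eqxx mulr1 big1 ?addr0 // => k /negPf->.
  by rewrite mulr0.
have pick' (f : 'I_n -> R) : \sum_k f k * (i == k)%:R = f i.
  by rewrite -[RHS]pick; apply: eq_bigr => k _; rewrite eq_sym.
rewrite !big_split /= -!mulr_sumr sum_d_dy // !pick pick'. ring.
Qed.

(** With P_j the derivative of P in y^j, the coefficients N^i_j are
    P_j y^i + P delta^i_j.  By the equation for P and Euler's identity
    for P and for the 0-homogeneous P_j, the spray S satisfies S(P) = - P^2 and
    S(P_j) = P P_j; the three parts of R^i_j then cancel. *)
Lemma Rcoef0 i j p : A p -> Rcoef G i j p = 0.
Proof.
move=> Ap; have NN := sumNN i j Ap; rewrite /Rcoef /delta_dx.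
rewrite [X in _ + X = _]NN.
have -> : \sum_k Ncoef G k j p * d_dy k (fun q => G q 0 i) p
    = \sum_k Ncoef G i k p * Ncoef G k j p.
  by apply: eq_bigr => k _; rewrite mulrC.
rewrite [X in 2 * (_ - X)]NN; have [_ E] := dG (ex j) i Ap; rewrite /d_dx E /= mxE mulr0.
rewrite /act (derive_near_eq oU (spray G p) (NE i j) Ap).
have dd : is_derive p (spray G p) (d_dy j P) (P p * d_dy j P p).
  rewrite -act_spray_dP //; apply/derivableP/diff_derivable.
  by apply: (@Ck_differentiable _ _ U _ 0%N) => //; have [_] := sP 2%N; apply.
have [_ ->] := is_derive_add
  (is_derive_mul dd (is_derive_coord2 i p (spray G p)))
  (is_derive_mul (dP (spray G p) Ap) (is_derive_const (i == j)%:R p (spray G p))).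
rewrite act_spray_P // funk // -/(ey j) -/(d_dy j P p).
rewrite /spray /G /= !mxE.
by move: (d_dy j P p) (i == j)%:R => a b; ring.
Qed.

End Curvature.

(** * Nondegeneracy of the fundamental tensor *)

Section Rank.
Context {R : realType} {n : nat}.
Notation V := 'rV[R]_n.
Notation TV := ('rV[R]_n * 'rV[R]_n)%type.
Variables (U : set V) (F : TV -> R).
Hypotheses (oU : open U) (sF : smooth_on (slit_tangent U) F)
  (hF : homogeneous1 U F).
Let A := slit_tangent U.
Let oA : open A := open_slit_tangent oU.
Let E := sq F.

Lemma fundamental_form p (w : V) : A p ->
  (w *m fundamental F p *m w^T) 0 0
  = 2^-1 * 'D_((0, w) : TV) ('D_((0, w) : TV) E) p.
Proof.
move=> Ap; have sE := smooth_sq oU sF.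
have dE := Ck_differentiable (sE 1%N).
rewrite (derive_near_eq oU (0, w) (g := fun q => \sum_j w 0 j * d_dy j E q))
  => [||//]; last first.
  by move=> q Aq; rewrite -sum_ey derive_sum_dir //; exact: dE.
have dd j : is_derive p ((0, w) : TV) (fun q => w 0 j * d_dy j E q)
    (w 0 j * 'D_((0, w) : TV) (d_dy j E) p).
  have dj : is_derive p ((0, w) : TV) (d_dy j E) ('D_((0, w) : TV) (d_dy j E) p).
    apply/derivableP/diff_derivable.
    by apply: (@Ck_differentiable _ _ U _ 0%N) => //; have [_] := sE 2%N; apply.
  apply: is_derive_eq (is_derive_mul (is_derive_const (w 0 j) _ _) dj) _.
  by rewrite mul0r add0r.
rewrite (_ : (fun q => _) = \sum_j (fun q => w 0 j * d_dy j E q)); last first.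
  by apply/funext => q; rewrite fct_sumE.
have [_ ->] := is_derive_sum dd.
rewrite mxE mulr_sumr; apply: eq_bigr => j _.
rewrite !mxE -sum_ey derive_sum_dir; last first.
  by apply: (@Ck_differentiable _ _ U _ 0%N) => //; have [_] := sE 2%N; apply.
rewrite mulr_suml !mulr_sumr; apply: eq_bigr => i _.
by rewrite mxE /d_dy; move: ('D__ _ p) => a; ring.
Qed.

Lemma derive2_sq p (w : V) : A p ->
  'D_((0, w) : TV) ('D_((0, w) : TV) E) p
  = 2 * ('D_((0, w) : TV) F p ^+ 2
         + F p * 'D_((0, w) : TV) ('D_((0, w) : TV) F) p).
Proof.
move=> Ap; set v : TV := (0, w).
rewrite (derive_near_eq oU v (g := fun q => 2 * F q * 'D_v F q)) => [||//]; last first.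
  by move=> q Aq; rewrite (derive_sq sF).
have dF := smooth_is_derive v sF Ap.
have ddF : is_derive p v ('D_v F) ('D_v ('D_v F) p).
  apply/derivableP/diff_derivable.
  by apply: (@Ck_differentiable _ _ U _ 0%N) => //; have [_] := sF 2%N; apply.
have [_ ->] := is_derive_mul (is_derive_mul (is_derive_const 2 p v) dF) ddF.
by move: ('D_v F p) ('D_v _ p) => a b; ring.
Qed.

(** A vector w in the kernel of the fundamental tensor satisfies
    F_w^2 + F F_ww = 0.  Both terms are nonnegative, so F_ww = 0 and w = t y; then
    F_w = t F by Euler's identity, and F_w = 0 forces t = 0. *)
Lemma rank_fundamental p : A p -> 0 < F p ->
  (forall w : V, 0 <= 'D_((0, w) : TV) ('D_((0, w) : TV) F) p) ->
  (forall w : V, 'D_((0, w) : TV) ('D_((0, w) : TV) F) p = 0 ->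
     exists t, w = t *: p.2) ->
  \rank (fundamental F p) = n.
Proof.
move=> Ap F0 F2ge0 F2eq0; apply/eqP/inj_row_free => w wg0.
have : (w *m fundamental F p *m w^T) 0 0 = 0 by rewrite wg0 mul0mx mxE.
rewrite fundamental_form // derive2_sq // => /eqP.
rewrite !mulf_eq0 invr_eq0 pnatr_eq0 /=.
rewrite (paddr_eq0 (sqr_ge0 _) (mulr_ge0 (ltW F0) (F2ge0 w))).
rewrite sqrf_eq0 mulf_eq0 (gt_eqF F0) /=.
case/andP => /eqP DF0 /eqP /F2eq0 [t wE]; move: DF0; rewrite wE.
have -> : ((0, t *: p.2) : TV) = t *: liouville p + 0.
  by congr pair; rewrite /= ?scaler0 !addr0.
rewrite derive_linear_dir; last exact: (Ck_differentiable (sF 1%N) Ap).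
rewrite derive0 addr0 (euler_slit hF sF Ap) => /eqP.
by rewrite mulf_eq0 (gt_eqF F0) orbF => /eqP->; rewrite scale0r.
Qed.

End Rank.

(** * The Euclidean inner product *)

Section InnerProduct.
Context {R : realType} {n : nat}.
Notation V := 'rV[R]_n.
Implicit Types (x y z : V) (a : R).

Lemma dotpC x y : dotp x y = dotp y x.
Proof. by apply: eq_bigr => i _; rewrite mulrC. Qed.

Lemma dotpDr x y z : dotp x (y + z) = dotp x y + dotp x z.
Proof. by rewrite -big_split; apply: eq_bigr => i _; rewrite !mxE mulrDr. Qed.

Lemma dotpZr a x y : dotp x (a *: y) = a * dotp x y.
Proof. by rewrite mulr_sumr; apply: eq_bigr => i _; rewrite !mxE mulrCA. Qed.

Lemma dotpDl x y z : dotp (x + y) z = dotp x z + dotp y z.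
Proof. by rewrite dotpC dotpDr !(dotpC z). Qed.

Lemma dotpZl a x y : dotp (a *: x) y = a * dotp x y.
Proof. by rewrite dotpC dotpZr dotpC. Qed.

Lemma dotp0r x : dotp x 0 = 0.
Proof. by rewrite -[X in dotp x X](scale0r 0) dotpZr mul0r. Qed.

Lemma dotp0l x : dotp 0 x = 0.
Proof. by rewrite dotpC dotp0r. Qed.

Lemma dotp_ge0 x : 0 <= dotp x x.
Proof. by apply: sumr_ge0 => i _; rewrite -expr2 sqr_ge0. Qed.

Lemma dotp_eq0 x : dotp x x = 0 -> x = 0.
Proof.
move=> /eqP; rewrite psumr_eq0 => [/allP x0|i _]; last by rewrite -expr2 sqr_ge0.
apply/rowP => i; have := x0 i (mem_index_enum i).
by rewrite mxE -expr2 sqrf_eq0 => /eqP.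
Qed.

Lemma dotp_gt0 x : x != 0 -> 0 < dotp x x.
Proof.
move=> x0; rewrite lt_def dotp_ge0 andbT; apply: contraNneq x0 => /dotp_eq0->.
exact: eqxx.
Qed.

Lemma sqr_enorm x : enorm x ^+ 2 = dotp x x.
Proof. exact/sqr_sqrtr/dotp_ge0. Qed.

Lemma dotpE x y : dotp x y = (x *m y^T) 0 0.
Proof. by rewrite mxE; apply: eq_bigr => i _; rewrite mxE. Qed.

End InnerProduct.

Section DotDerivative.
Context {R : realType} {n : nat}.
Notation TV := ('rV[R]_n * 'rV[R]_n)%type.
Implicit Types (p v : TV) (A : set TV).

Lemma is_derive_dotp (f g : TV -> 'rV[R]_n) p v (df dg : 'rV[R]_n) :
  (forall i, is_derive p v (fun q => f q 0 i) (df 0 i)) ->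
  (forall i, is_derive p v (fun q => g q 0 i) (dg 0 i)) ->
  is_derive p v (fun q => dotp (f q) (g q)) (dotp df (g p) + dotp (f p) dg).
Proof.
move=> fd gd; have fgd i := is_derive_mul (fd i) (gd i).
rewrite /dotp -big_split (_ : (fun q => _) = \sum_i (fun q => f q 0 i * g q 0 i)).
  exact: is_derive_sum.
by apply/funext => q; rewrite fct_sumE.
Qed.

Lemma is_derive_dotp11 p v :
  is_derive p v (fun q => dotp q.1 q.1) (2 * dotp p.1 v.1).
Proof.
have d i := is_derive_coord1 i p v.
apply: is_derive_eq (is_derive_dotp d d) _; rewrite dotpC; ring.
Qed.

Lemma is_derive_dotp22 p v :
  is_derive p v (fun q => dotp q.2 q.2) (2 * dotp p.2 v.2).
Proof.
have d i := is_derive_coord2 i p v.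
apply: is_derive_eq (is_derive_dotp d d) _; rewrite dotpC; ring.
Qed.

Lemma is_derive_dotp12 p v :
  is_derive p v (fun q => dotp q.1 q.2) (dotp v.1 p.2 + dotp p.1 v.2).
Proof.
exact: is_derive_dotp (fun i => is_derive_coord1 i p v) (fun i => is_derive_coord2 i p v).
Qed.

Lemma is_derive_dotp1 w p v : is_derive p v (fun q => dotp q.1 w) (dotp v.1 w).
Proof.
have dw i : is_derive p v (fun=> w 0 i) ((0 : 'rV[R]_n) 0 i).
  by rewrite mxE; exact: is_derive_const.
apply: is_derive_eq (is_derive_dotp (fun i => is_derive_coord1 i p v) dw) _.
by rewrite dotp0r addr0.
Qed.

Lemma is_derive_dotp2 w p v : is_derive p v (fun q => dotp q.2 w) (dotp v.2 w).
Proof.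
have dw i : is_derive p v (fun=> w 0 i) ((0 : 'rV[R]_n) 0 i).
  by rewrite mxE; exact: is_derive_const.
apply: is_derive_eq (is_derive_dotp (fun i => is_derive_coord2 i p v) dw) _.
by rewrite dotp0r addr0.
Qed.

Lemma Ck_dotp11 A k : open A -> Ck_on k A (fun q => dotp q.1 q.1).
Proof. by move=> oA; apply: Ck_sum => // i; apply: CkM => //; exact: Ck_coord1. Qed.

Lemma Ck_dotp22 A k : open A -> Ck_on k A (fun q => dotp q.2 q.2).
Proof. by move=> oA; apply: Ck_sum => // i; apply: CkM => //; exact: Ck_coord2. Qed.

Lemma Ck_dotp12 A k : open A -> Ck_on k A (fun q => dotp q.1 q.2).
Proof.
move=> oA; apply: Ck_sum => // i.
by apply: CkM => //; [exact: Ck_coord1|exact: Ck_coord2].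
Qed.

End DotDerivative.

(** * The Riemannian part alpha *)

Section Alpha.
Context {R : realType} {n : nat}.
Notation V := 'rV[R]_n.
Notation TV := ('rV[R]_n * 'rV[R]_n)%type.
Variables (c : R) (U : set V).
Hypotheses (oU : open U) (hU : forall x, U x -> 4 * c ^+ 2 * enorm x ^+ 2 < 1).
Let A := slit_tangent U.
Let oA : open A := open_slit_tangent oU.

Definition lam (p : TV) : R := 1 - 4 * c ^+ 2 * dotp p.1 p.1.
Definition beta (p : TV) : R := 2 * c * dotp p.1 p.2.
Definition quad (p : TV) : R := lam p * dotp p.2 p.2 + beta p ^+ 2.
(** On each fibre, the norm of the inner product a = lam <,> + beta (x) beta. *)
Definition alpha (p : TV) : R := Num.sqrt (quad p).

Lemma rootcE p : rootc c p.1 p.2 = alpha p.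
Proof.
by rewrite /rootc /alpha /quad /lam /beta !sqr_enorm; congr Num.sqrt; ring.
Qed.

Lemma lam_gt0 p : U p.1 -> 0 < lam p.
Proof. by move=> /hU; rewrite /lam subr_gt0 sqr_enorm. Qed.

Lemma beta2_lt_quad p : A p -> beta p ^+ 2 < quad p.
Proof.
by move=> [Up p0]; rewrite ltrDr mulr_gt0 ?lam_gt0 ?dotp_gt0.
Qed.

Lemma quad_gt0 p : A p -> 0 < quad p.
Proof. by move=> /beta2_lt_quad; apply: le_lt_trans; exact: sqr_ge0. Qed.

Lemma alpha_gt0 p : A p -> 0 < alpha p.
Proof. by move=> Ap; rewrite sqrtr_gt0 quad_gt0. Qed.

Lemma sqr_alpha p : U p.1 -> alpha p ^+ 2 = quad p.
Proof.
move=> Up; apply: sqr_sqrtr.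
by rewrite addr_ge0 ?sqr_ge0 // mulr_ge0 ?dotp_ge0 ?ltW ?lam_gt0.
Qed.

(** Holds because lam |y|^2 > 0 is the difference of the squares.  This is the
    Randers condition, and it gives positivity and convexity of both metrics. *)
Lemma norm_beta_lt p : A p -> `|beta p| < alpha p.
Proof.
by move=> Ap; rewrite -sqrtr_sqr ltr_sqrt ?quad_gt0 // beta2_lt_quad.
Qed.

Lemma norm_beta_le p : U p.1 -> `|beta p| <= alpha p.
Proof.
move=> Up; rewrite -sqrtr_sqr ler_wsqrtr // lerDr mulr_ge0 ?dotp_ge0 //.
exact/ltW/lam_gt0.
Qed.

Lemma is_derive_lam p v :
  is_derive p v lam (- (8 * c ^+ 2 * dotp p.1 v.1)).
Proof.
apply: is_derive_eq (is_deriveB (is_derive_const 1 p v)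
  (is_derive_mul (is_derive_const (4 * c ^+ 2) p v) (is_derive_dotp11 p v))) _.
by rewrite mul0r; ring.
Qed.

Lemma is_derive_beta p v :
  is_derive p v beta (2 * c * (dotp v.1 p.2 + dotp p.1 v.2)).
Proof.
apply: is_derive_eq
  (is_derive_mul (is_derive_const (2 * c) p v) (is_derive_dotp12 p v)) _.
by rewrite mul0r add0r.
Qed.

Definition dquad (p v : TV) : R :=
  - (8 * c ^+ 2 * dotp p.1 v.1) * dotp p.2 p.2 + lam p * (2 * dotp p.2 v.2)
  + 2 * beta p * (2 * c * (dotp v.1 p.2 + dotp p.1 v.2)).

Lemma is_derive_quad p v : is_derive p v quad (dquad p v).
Proof.
have db := is_derive_beta p v.
have := is_derive_add (is_derive_mul (is_derive_lam p v) (is_derive_dotp22 p v))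
  (is_derive_mul db db).
rewrite (_ : (fun q => _) = quad) => [d|].
  by apply: is_derive_eq d _; rewrite /dquad; ring.
by apply/funext => q; rewrite /quad expr2.
Qed.

Lemma is_derive_alpha p v : A p ->
  is_derive p v alpha (dquad p v / (2 * alpha p)).
Proof.
by move=> Ap; exact: is_derive_sqrt (quad_gt0 Ap) (is_derive_quad p v).
Qed.

Lemma Ck_lam B k : open B -> Ck_on k B lam.
Proof.
move=> oB.
rewrite (_ : lam = fun q => 1 + (- (4 * c ^+ 2)) * dotp q.1 q.1); last first.
  by apply/funext => q; rewrite /lam mulNr.
apply: CkD => //; first exact: Ck_cst.
by apply: CkM => //; [exact: Ck_cst|exact: Ck_dotp11].
Qed.

Lemma Ck_beta B k : open B -> Ck_on k B beta.
Proof. by move=> oB; apply: CkM => //; [exact: Ck_cst|exact: Ck_dotp12]. Qed.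

Lemma Ck_quad B k : open B -> Ck_on k B quad.
Proof.
move=> oB; rewrite (_ : quad = fun q => lam q * dotp q.2 q.2 + beta q * beta q).
  apply: CkD => //; apply: CkM => //.
  - exact: Ck_lam.
  - exact: Ck_dotp22.
  - exact: Ck_beta.
  - exact: Ck_beta.
by apply/funext => q; rewrite /quad expr2.
Qed.

Lemma smooth_alpha : smooth_on A alpha.
Proof.
move=> k; apply: Ck_sqrt => //; [exact: quad_gt0|exact: Ck_quad].
Qed.

Lemma continuous_alpha : continuous alpha.
Proof.
move=> p; apply: (@continuous_comp _ _ _ quad (@Num.sqrt R)).
  by apply: (Ck_quad 0%N openT p); rewrite inE.
exact: sqrt_continuous.
Qed.

Lemma continuous_lam : continuous lam.
Proof. by move=> p; apply: (Ck_lam 0%N openT p); rewrite inE. Qed.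

Lemma continuous_beta : continuous beta.
Proof. by move=> p; apply: (Ck_beta 0%N openT p); rewrite inE. Qed.

Lemma alphaZ x y t : 0 < t -> alpha (x, t *: y) = t * alpha (x, y).
Proof.
move=> t0; rewrite /alpha (_ : quad _ = t ^+ 2 * quad (x, y)).
  by rewrite sqrtrM ?sqr_ge0 // sqrtr_sqr gtr0_norm.
by rewrite /quad /beta /lam /= !(dotpZr, dotpZl); ring.
Qed.

Lemma alpha0 x : alpha (x, 0) = 0.
Proof. by rewrite /alpha /quad /beta /= !dotp0r !mulr0 expr0n addr0 sqrtr0. Qed.

(** The product a(y, w). *)
Definition inner (p : TV) (w : V) : R :=
  lam p * dotp p.2 w + beta p * (2 * c * dotp p.1 w).
(** The squared norm a(w, w). *)
Definition inner_sq (p : TV) (w : V) : R :=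
  lam p * dotp w w + (2 * c * dotp p.1 w) ^+ 2.

Lemma is_derive_alpha_y p w : A p ->
  is_derive p ((0, w) : TV) alpha (inner p w / alpha p).
Proof.
move=> Ap; have a0 := alpha_gt0 Ap.
apply: is_derive_eq (is_derive_alpha (0, w) Ap) _.
by rewrite /dquad /inner /= dotp0r dotp0l; field; rewrite gt_eqF.
Qed.

(** The second fibre derivative of alpha in the direction w. *)
Definition d2alpha (p : TV) (w : V) : R :=
  (inner_sq p w - (inner p w / alpha p) ^+ 2) / alpha p.

Lemma is_derive2_alpha_y p w : A p ->
  is_derive p ((0, w) : TV) (fun q => inner q w / alpha q) (d2alpha p w).
Proof.
move=> Ap; have a0 := alpha_gt0 Ap; set v : TV := (0, w).
have dl := is_derive_lam p v; have db := is_derive_beta p v.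
have dyw := is_derive_dotp2 w p v; have dxw := is_derive_dotp1 w p v.
have da := is_derive_alpha_y w Ap.
apply: is_derive_eq (is_derive_mul (is_derive_add (is_derive_mul dl dyw)
  (is_derive_mul db (is_derive_mul (is_derive_const (2 * c) p v) dxw)))
  (is_derive_inv (lt0r_neq0 a0) da)) _.
rewrite /= !dotp0r !dotp0l /d2alpha /inner_sq /inner.
by field; rewrite gt_eqF.
Qed.

(** The quantity a(w,w) - a(y,w)^2 / a(y,y) is the squared a-norm of the component
    of w orthogonal to y, whence the sign and the equality case of the next two
    lemmas. *)
Lemma d2alphaE p w : A p ->
  d2alpha p w = inner_sq p (w - (inner p w / alpha p ^+ 2) *: p.2) / alpha p.
Proof.
move=> Ap; have a0 := alpha_gt0 Ap; rewrite /d2alpha; congr (_ / _).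
have aE : alpha p ^+ 2 = lam p * dotp p.2 p.2 + beta p * (2 * c * dotp p.1 p.2).
  by rewrite sqr_alpha; [rewrite /quad expr2|case: Ap].
set t := inner p w / alpha p ^+ 2.
have -> : (inner p w / alpha p) ^+ 2 = 2 * t * inner p w - t ^+ 2 * alpha p ^+ 2.
  by rewrite /t; field; rewrite gt_eqF.
rewrite aE /inner /inner_sq -(scaleNr t p.2) !(dotpDl, dotpDr, dotpZl, dotpZr) (dotpC w p.2).
by rewrite /beta; ring.
Qed.

Lemma d2alpha_ge0 p w : A p -> 0 <= d2alpha p w.
Proof.
move=> Ap; rewrite d2alphaE // divr_ge0 ?(ltW (alpha_gt0 Ap)) //.
rewrite /inner_sq addr_ge0 ?sqr_ge0 // mulr_ge0 ?dotp_ge0 ?ltW //.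
by apply: lam_gt0; case: Ap.
Qed.

Lemma d2alpha_eq0 p w : A p -> d2alpha p w = 0 -> exists t, w = t *: p.2.
Proof.
move=> Ap; have l0 : 0 < lam p by apply: lam_gt0; case: Ap.
rewrite d2alphaE // => /eqP; rewrite mulf_eq0 invr_eq0 (gt_eqF (alpha_gt0 Ap)).
rewrite orbF /inner_sq (paddr_eq0 (mulr_ge0 (ltW l0) (dotp_ge0 _)) (sqr_ge0 _)).
rewrite mulf_eq0 (gt_eqF l0) /= => /andP[/eqP /dotp_eq0 /eqP + _].
by rewrite subr_eq0 => /eqP; exists (inner p w / alpha p ^+ 2).
Qed.

End Alpha.

(** * The two metrics *)

Section Metrics.
Context {R : realType} {n : nat}.
Notation V := 'rV[R]_n.
Notation TV := ('rV[R]_n * 'rV[R]_n)%type.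
Variables (c eta : R) (U : set V).
Hypotheses (oU : open U) (hU : forall x, U x -> 4 * c ^+ 2 * enorm x ^+ 2 < 1)
  (eta0 : 0 < eta).
Let A := slit_tangent U.
Let oA : open A := open_slit_tangent oU.
Local Notation F := (randersF c : TV -> R).
Local Notation Fb := (Fbar c eta : TV -> R).

Let l0 p : A p -> lam c p != 0.
Proof. by move=> [Up _]; rewrite gt_eqF // (lam_gt0 hU). Qed.

Let a0 p : A p -> alpha c p != 0.
Proof. by move=> Ap; rewrite gt_eqF // (alpha_gt0 hU). Qed.

Lemma randersE p : F p = (alpha c p + beta c p) * (lam c p)^-1.
Proof.
case: p => x y; rewrite /randersF -(rootcE c (x, y)) /=.
by rewrite /lam /beta /= sqr_enorm [RHS]mulrDl.
Qed.

Lemma FbarE p : Fb p = eta * (F p * F p) * (alpha c p)^-1.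
Proof.
case: p => x y; rewrite randersE -(rootcE c (x, y)) /=.
rewrite /Fbar /lam /beta /= sqr_enorm !invfM; ring.
Qed.

Lemma is_derive_randers p v : A p -> is_derive p v F ('D_v F p).
Proof.
move=> Ap; apply: derivableP; rewrite (funext randersE).
by have [] := is_derive_mul
  (is_derive_add (is_derive_alpha hU v Ap) (is_derive_beta c p v))
  (is_derive_inv (l0 Ap) (is_derive_lam c p v)).
Qed.

Lemma smooth_randers : smooth_on A F.
Proof.
move=> k; rewrite (funext randersE); apply: CkM => //.
  by apply: CkD => //; [exact: smooth_alpha|exact: Ck_beta].
by apply: CkV => //; exact: Ck_lam.
Qed.

Lemma smooth_Fbar : smooth_on A Fb.
Proof.
move=> k; rewrite (funext FbarE); apply: CkM => //.
  apply: CkM => //; first exact: Ck_cst.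
  by apply: CkM => //; exact: smooth_randers.
by apply: CkV => //; exact: smooth_alpha.
Qed.

Lemma randers_gt0 p : A p -> 0 < F p.
Proof.
move=> Ap; rewrite randersE divr_gt0 ?(lam_gt0 hU) //; last by case: Ap.
have := norm_beta_lt hU Ap; rewrite ltr_norml => /andP[+ _].
by rewrite -subr_gt0 opprK addrC.
Qed.

Lemma Fbar_gt0 p : A p -> 0 < Fb p.
Proof.
move=> Ap; have F0 := randers_gt0 Ap.
by rewrite FbarE !mulr_gt0 // invr_gt0 (alpha_gt0 hU).
Qed.

Lemma homogeneous_randers : homogeneous1 U F.
Proof.
move=> x y t Ux t0; rewrite !randersE alphaZ // /beta /lam /= dotpZr.
by rewrite [RHS]mulrA; congr (_ * _); ring.
Qed.

Lemma homogeneous_Fbar : homogeneous1 U Fb.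
Proof.
move=> x y t Ux t0; rewrite !FbarE homogeneous_randers // alphaZ // invfM.
move: (alpha c _)^-1 (F _) => a f; field; exact: lt0r_neq0.
Qed.

Lemma continuous_randers p : U p.1 -> {for p, continuous F}.
Proof.
move=> Up; rewrite (funext randersE); apply: cvgM.
  by apply: cvgD; [exact: continuous_alpha|exact: continuous_beta].
by apply: cvgV; [rewrite gt_eqF // (lam_gt0 hU)|exact: continuous_lam].
Qed.

(** Holds since |beta| <= alpha.  It is used for the continuity of Fbar at y = 0,
    where the formula for Fbar divides by zero. *)
Lemma norm_Fbar_le p : U p.1 -> `|Fb p| <= 4 * eta * alpha c p / lam c p ^+ 2.
Proof.
move=> Up; have lp := lam_gt0 hU Up.
have := norm_beta_le hU Up; set a := alpha c p; set b := beta c p => ba.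
have [a00|an0] := eqVneq a 0.
  by rewrite FbarE -/a a00 invr0 !mulr0 normr0 mul0r.
have ap : 0 < a by rewrite lt_def an0 sqrtr_ge0.
have -> : Fb p = eta * (a + b) ^+ 2 / (a * lam c p ^+ 2).
  by rewrite FbarE randersE -/a -/b; field; rewrite an0 gt_eqF.
have -> : 4 * eta * a / lam c p ^+ 2 = eta * (2 * a) ^+ 2 / (a * lam c p ^+ 2).
  by field; rewrite an0 gt_eqF.
rewrite ger0_norm; last first.
  by rewrite divr_ge0 // mulr_ge0 ?sqr_ge0 // ltW.
rewrite ler_pM2r ?invr_gt0 ?mulr_gt0 ?exprn_gt0 // ler_pM2l //.
move: ba; rewrite ler_norml => /andP[ba1 ba2].
have ab0 : 0 <= a + b by rewrite addrC -lerBlDr sub0r.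
by rewrite ler_sqr ?nnegrE //; lra.
Qed.

Lemma continuous_Fbar p : U p.1 -> {for p, continuous Fb}.
Proof.
move=> Up; have [p0|pn0] := eqVneq p.2 0; last first.
  by apply: (smooth_Fbar 0%N p); rewrite inE; split.
have a_0 : alpha c p = 0 by case: (p) p0 => x y /= ->; exact: alpha0.
have nU : \forall q \near p, U q.1.
  exact: (@cvg_fst _ _ (nbhs p.1) (nbhs p.2) _ U (open_nbhs_nbhs (conj oU Up))).
have Fb0 : Fb p = 0 by rewrite FbarE a_0 invr0 mulr0.
suff : Fb q @[q --> p] --> (0 : R) by rewrite -Fb0.
apply/cvgr0Pnorm_le => e e0.
have : (4 * eta * alpha c q / lam c q ^+ 2) @[q --> p]
    --> (4 * eta * alpha c p / lam c p ^+ 2).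
  apply: cvgM.
    by apply: cvgM; [exact: cvg_cst|exact: continuous_alpha].
  apply: cvgV; first by rewrite expf_neq0 // gt_eqF // (lam_gt0 hU).
  apply: (@cvg_comp _ _ _ (lam c) (fun x => x ^+ 2)); first exact: continuous_lam.
  exact: exprn_continuous.
rewrite a_0 mulr0 mul0r => /cvgr0_norm_le /(_ e e0); apply: filterS2 nU => q Uq.
by apply: le_trans; apply: le_trans (norm_Fbar_le Uq) (ler_norm _).
Qed.

(** The differential equation of the Funk metric.  It becomes a rational identity
    once |y|^2 is expressed as (alpha^2 - beta^2) / lam. *)
Lemma funk_randers p (u : V) : A p ->
  'D_((u, 0) : TV) F p = 2 * c * F p * 'D_((0, u) : TV) F p.
Proof.
move=> Ap; have lp := l0 Ap; have ap := a0 Ap.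
have D v := is_derive_mul
  (is_derive_add (is_derive_alpha hU v Ap) (is_derive_beta c p v))
  (is_derive_inv (l0 Ap) (is_derive_lam c p v)).
have aE : alpha c p ^+ 2 = quad c p by exact: (sqr_alpha hU Ap.1).
rewrite (funext randersE); have [_ ->] := D (u, 0); have [_ ->] := D (0, u).
rewrite /dquad /= !dotp0r !dotp0l (dotpC u).
have yE : dotp p.2 p.2 = (alpha c p ^+ 2 - beta c p ^+ 2) / lam c p.
  by rewrite aE /quad addrK mulrC mulKf.
rewrite yE; field; by rewrite lp ap.
Qed.

(** The counterpart for alpha of [funk_randers]; the two together yield
    [flat_Fbar]. *)
Lemma derive_x_alpha p (u : V) : A p -> 'D_((u, 0) : TV) (alpha c) p
  = 2 * c * (F p * 'D_((0, u) : TV) (alpha c) p - alpha c p * 'D_((0, u) : TV) F p).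
Proof.
move=> Ap; have lp := l0 Ap; have ap := a0 Ap.
have D v := is_derive_mul
  (is_derive_add (is_derive_alpha hU v Ap) (is_derive_beta c p v))
  (is_derive_inv (l0 Ap) (is_derive_lam c p v)).
have aE : alpha c p ^+ 2 = quad c p by exact: (sqr_alpha hU Ap.1).
rewrite (funext randersE); have [_ ->] := D (0, u).
have [_ ->] := is_derive_alpha hU (0, u) Ap.
have [_ ->] := is_derive_alpha hU (u, 0) Ap.
rewrite /dquad /= !dotp0r !dotp0l (dotpC u).
have yE : dotp p.2 p.2 = (alpha c p ^+ 2 - beta c p ^+ 2) / lam c p.
  by rewrite aE /quad addrK mulrC mulKf.
rewrite yE; field; by rewrite lp ap.
Qed.

(** The Rapcsak condition with P = cF. *)
Lemma flat_randers p (u : V) : A p -> 'D_((u, 0) : TV) F p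
  = 'D_((0, u) : TV) (fun q => c * F q * F q) p.
Proof.
move=> Ap; rewrite funk_randers //.
have d := is_derive_randers (0, u) Ap.
have [_ ->] := is_derive_mul (is_derive_mul (is_derive_const c _ _) d) d.
by move: ('D__ F p) => a; ring.
Qed.

Lemma is_derive_Fbar p v dF da : A p ->
  is_derive p v F dF -> is_derive p v (alpha c) da ->
  is_derive p v Fb
    (eta * (2 * F p * dF * (alpha c p)^-1 - F p * F p * (da * (alpha c p) ^- 2))).
Proof.
move=> Ap Fd ad; rewrite (funext FbarE).
apply: is_derive_eq (is_derive_mul (is_derive_mul (is_derive_const eta p v)
  (is_derive_mul Fd Fd)) (is_derive_inv (a0 Ap) ad)) _.
by field; exact: a0.
Qed.

(** The Rapcsak condition with P = 2cF. *)
Lemma flat_Fbar p (u : V) : A p -> 'D_((u, 0) : TV) Fb p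
  = 'D_((0, u) : TV) (fun q => 2 * c * F q * Fb q) p.
Proof.
move=> Ap; have ap := a0 Ap.
have dF v := is_derive_randers v Ap.
have da v : is_derive p v (alpha c) ('D_v (alpha c) p).
  by have [d _] := is_derive_alpha hU v Ap; exact: derivableP.
have dFb v := is_derive_Fbar Ap (dF v) (da v).
have [_ ->] := dFb (u, 0).
have [_ ->] := is_derive_mul (is_derive_mul (is_derive_const (2 * c) _ _)
  (dF (0, u))) (dFb (0, u)).
rewrite funk_randers // derive_x_alpha // FbarE.
by move: ('D_((0, u) : TV) F p) ('D_((0, u) : TV) (alpha c) p) => a b; field.
Qed.

Let da (w : V) (q : TV) : R := inner c q w / alpha c q.
Let dF (w : V) (q : TV) : R := (da w q + 2 * c * dotp q.1 w) / lam c q.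

Let is_derive_lam_y q w : is_derive q ((0, w) : TV) (lam c) 0.
Proof.
by apply: is_derive_eq (is_derive_lam c _ _) _; rewrite /= dotp0r mulr0 oppr0.
Qed.

Lemma is_derive_randers_y q w : A q -> is_derive q ((0, w) : TV) F (dF w q).
Proof.
move=> Aq; rewrite (funext randersE).
apply: is_derive_eq (is_derive_mul
  (is_derive_add (is_derive_alpha_y hU w Aq) (is_derive_beta c q (0, w)))
  (is_derive_inv (l0 Aq) (is_derive_lam_y q w))) _.
by rewrite /= dotp0l add0r oppr0 mul0r mulr0 addr0.
Qed.

Lemma is_derive2_randers_y p w : A p ->
  is_derive p ((0, w) : TV) (dF w) (d2alpha c p w / lam c p).
Proof.
move=> Ap; set v : TV := (0, w).
apply: is_derive_eq (is_derive_mul (is_derive_add (is_derive2_alpha_y hU w Ap)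
    (is_derive_mul (is_derive_const (2 * c) p v) (is_derive_dotp1 w p v)))
    (is_derive_inv (l0 Ap) (is_derive_lam_y p w))) _.
by rewrite /= dotp0l; field; rewrite l0 ?a0.
Qed.

Lemma derive2_randers p (w : V) : A p ->
  'D_((0, w) : TV) ('D_((0, w) : TV) F) p = d2alpha c p w / lam c p.
Proof.
move=> Ap; rewrite (derive_near_eq oU (0, w) (g := dF w) _ Ap); last first.
  by move=> q Aq; have [] := is_derive_randers_y w Aq.
by have [] := is_derive2_randers_y w Ap.
Qed.

Lemma derive2_Fbar p (w : V) : A p ->
  'D_((0, w) : TV) ('D_((0, w) : TV) Fb) p
  = eta / lam c p ^+ 2 * (d2alpha c p w * (1 - (beta c p / alpha c p) ^+ 2)
      + 2 / alpha c p * (2 * c * dotp p.1 w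
          - beta c p / alpha c p * (inner c p w / alpha c p)) ^+ 2).
Proof.
move=> Ap; set v : TV := (0, w); have [lp ap] := (l0 Ap, a0 Ap).
have Fd := is_derive_randers_y w Ap; have dFd := is_derive2_randers_y w Ap.
have ad : is_derive p v (alpha c) (da w p) := is_derive_alpha_y hU w Ap.
have dad : is_derive p v (da w) (d2alpha c p w) := is_derive2_alpha_y hU w Ap.
have iad := is_derive_inv ap ad.
rewrite (derive_near_eq oU v (g := fun q => eta * (2 * F q * dF w q * (alpha c q)^-1
  + -1 * (F q * F q * (da w q * ((alpha c q)^-1 * (alpha c q)^-1))))) _ Ap); last first.
  move=> q Aq; have [_ ->] :=
    is_derive_Fbar Aq (is_derive_randers_y w Aq) (is_derive_alpha_y hU w Aq).
  by rewrite mulN1r expr2 invfM.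
have [_ ->] := is_derive_mul (is_derive_const eta p v) (is_derive_add
  (is_derive_mul (is_derive_mul (is_derive_mul (is_derive_const 2 p v) Fd) dFd) iad)
  (is_derive_mul (is_derive_const (-1) p v) (is_derive_mul (is_derive_mul Fd Fd)
    (is_derive_mul dad (is_derive_mul iad iad))))).
rewrite randersE /dF /da.
move: (d2alpha c p w) (inner c p w) (dotp p.1 w) => a b d.
by field; rewrite lp ap.
Qed.

End Metrics.

(** * The Randers structure *)

Section RandersMetric.
Context {R : realType} {n : nat}.
Notation V := 'rV[R]_n.
Notation TV := ('rV[R]_n * 'rV[R]_n)%type.
Implicit Types x y : V.
Variables (c : R) (U : set V).
Hypotheses (oU : open U) (hU : forall x, U x -> 4 * c ^+ 2 * enorm x ^+ 2 < 1).

Let l (x : V) : R := lam c (x, 0).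

(** The matrix of a / lam^2. *)
Definition riemann (x : V) : 'M[R]_n :=
  (l x) ^- 2 *: (l x *: 1%:M + (4 * c ^+ 2) *: (x^T *m x)).
Definition drift (x : V) : V := (2 * c / l x) *: x.

Let lE (x y : V) : l x = lam c (x, y).
Proof. by []. Qed.

Let l_gt0 x : U x -> 0 < l x.
Proof. by move=> Ux; exact: (lam_gt0 (p := (x, 0)) hU Ux). Qed.

Lemma mulmx_riemann x y : y *m riemann x
  = (l x) ^- 2 *: (l x *: y + (4 * c ^+ 2 * dotp y x) *: x).
Proof.
rewrite /riemann -scalemxAr mulmxDr -!scalemxAr mulmx1 mulmxA.
by rewrite [y *m x^T]mx11_scalar mul_scalar_mx -dotpE scalerA.
Qed.

Lemma riemannE x y : (y *m riemann x *m y^T) 0 0 = (l x) ^- 2 * quad c (x, y).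
Proof.
rewrite -dotpE mulmx_riemann !(dotpZl, dotpDl) /quad /beta /= (dotpC y x).
by rewrite -(lE x y); ring.
Qed.

Lemma alpha_riemann x y : U x ->
  Num.sqrt ((y *m riemann x *m y^T) 0 0) = alpha c (x, y) / l x.
Proof.
move=> Ux; rewrite riemannE -(sqr_alpha (p := (x, y)) hU Ux) mulrC -exprVn.
by rewrite -exprMn sqrtr_sqr ger0_norm // divr_ge0 ?sqrtr_ge0 ?ltW ?l_gt0.
Qed.

Lemma riemann_gt0 x y : U x -> y != 0 -> 0 < (y *m riemann x *m y^T) 0 0.
Proof.
move=> Ux y0; rewrite riemannE mulr_gt0 ?invr_gt0 ?exprn_gt0 ?l_gt0 //.
exact: (quad_gt0 (p := (x, y)) hU).
Qed.

Lemma riemann_unit x : U x -> riemann x \in unitmx.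
Proof.
move=> Ux; rewrite -row_free_unit; apply: inj_row_free => y ya0.
apply/eqP; apply: contraT => /(riemann_gt0 Ux).
by rewrite ya0 mul0mx mxE ltxx.
Qed.

Lemma tr_riemann x : (riemann x)^T = riemann x.
Proof.
by rewrite /riemann linearZ linearD !linearZ /= trmx1 trmx_mul trmxK.
Qed.

(** The reason why the norm of [drift] is computable without inverting the matrix:
    x is an eigenvector, with eigenvalue lam^-2 since lam + 4c^2|x|^2 = 1. *)
Lemma mul_riemann x : x *m riemann x = (l x) ^- 2 *: x.
Proof.
rewrite mulmx_riemann -scalerDl (_ : _ + _ = 1) ?scale1r //.
by rewrite /l /lam subrK.
Qed.

(** By [mul_riemann], the squared norm is 4c^2|x|^2. *)
Lemma drift_norm x : U x ->
  Num.sqrt ((drift x *m invmx (riemann x) *m (drift x)^T) 0 0) < 1.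
Proof.
move=> Ux; have l0 := l_gt0 Ux.
have xV : x *m invmx (riemann x) = (l x) ^+ 2 *: x.
  rewrite -[LHS](scalerK (invr_neq0 (expf_neq0 2 (lt0r_neq0 l0)))) invrK.
  by rewrite scalemxAl -mul_riemann mulmxK // riemann_unit.
rewrite -dotpE /drift -scalemxAl xV !(dotpZl, dotpZr).
rewrite -[ltRHS]sqrtr1 ltr_sqrt ?ltr01 //.
rewrite (_ : _ * _ = 4 * c ^+ 2 * dotp x x); first by rewrite -sqr_enorm hU.
by field; exact: lt0r_neq0.
Qed.

Let coord_linear i : linear (fun x : V => x 0 i : R).
Proof. by move=> a x y; rewrite !mxE. Qed.

Let Ck_coord i k : Ck_on k U (fun x : V => x 0 i).
Proof.
by apply: Ck_linear; [exact: coord_linear|move=> x; exact: coord_continuous].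
Qed.

Let Ck_l k : Ck_on k U l.
Proof.
rewrite (_ : l = fun x => 1 + (- (4 * c ^+ 2)) * dotp x x); last first.
  by apply/funext => x; rewrite /l /lam mulNr.
apply: CkD => //; first exact: Ck_cst.
apply: CkM => //; first exact: Ck_cst.
by apply: Ck_sum => // i; apply: CkM.
Qed.

Let Ck_lV k : Ck_on k U (fun x => (l x)^-1).
Proof. by apply: CkV => // x /l_gt0; exact: lt0r_neq0. Qed.

Lemma smooth_drift : smooth_on U drift.
Proof.
move=> k; rewrite (_ : drift = fun x =>
    \sum_i (2 * c * (l x)^-1 * x 0 i) *: delta_mx 0 i); last first.
  apply/funext => x; rewrite /drift {2}[x]row_sum_delta scaler_sumr.
  by apply: eq_bigr => i _; rewrite scalerA.
apply: Ck_sum => // i; apply: CkZl => //; apply: CkM => //; apply: CkM => //.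
exact: Ck_cst.
Qed.

Lemma smooth_riemann : smooth_on U riemann.
Proof.
move=> k; rewrite (_ : riemann = fun x => \sum_i \sum_j
    ((l x)^-1 * (l x)^-1 * (l x * (i == j)%:R + 4 * c ^+ 2 * (x 0 i * x 0 j)))
      *: delta_mx i j); last first.
  apply/funext => x; rewrite [LHS]matrix_sum_delta.
  apply: eq_bigr => i _; apply: eq_bigr => j _; congr (_ *: _).
  by rewrite !mxE big_ord1 !mxE -invfM.
apply: Ck_sum => // i; apply: Ck_sum => // j; apply: CkZl => //.
apply: CkM => //; first exact: CkM.
apply: CkD => //; apply: CkM => //; first exact: Ck_cst.
  exact: Ck_cst.
exact: CkM.
Qed.

Lemma randers_metric_randers : randers_metric U (randersF c).
Proof.
exists riemann, drift; split.
- exact: smooth_riemann.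
- exact: smooth_drift.
- by move=> x Ux; split; [exact: tr_riemann|move=> y; exact: riemann_gt0].
- exact: drift_norm.
- move=> x y Ux; rewrite alpha_riemann // randersE mulrDl /drift dotpZl.
  by rewrite -(lE x y) /beta /=; congr (_ + _); rewrite mulrAC.
Qed.

End RandersMetric.

(** * Assembling the theorem *)

Section FinslerMetrics.
Context {R : realType} {n : nat}.
Notation V := 'rV[R]_n.
Notation TV := ('rV[R]_n * 'rV[R]_n)%type.
Variables (c eta : R) (U : set V).
Hypotheses (oU : open U) (hU : forall x, U x -> 4 * c ^+ 2 * enorm x ^+ 2 < 1)
  (eta0 : 0 < eta).
Let A := slit_tangent U.
Local Notation F := (randersF c : TV -> R).
Local Notation Fb := (Fbar c eta : TV -> R).

Lemma finsler_randers : finsler_metric U F.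
Proof.
split.
- apply: continuous_in_subspaceT => p; rewrite inE => Up.
  exact: (continuous_randers hU Up).
- exact: smooth_randers.
- exact: randers_gt0.
- exact: homogeneous_randers.
move=> p Ap; have lp : 0 < lam c p := lam_gt0 hU Ap.1.
apply: (rank_fundamental oU) => //.
- exact: smooth_randers.
- exact: homogeneous_randers.
- exact: (randers_gt0 hU Ap).
- by move=> w; rewrite (derive2_randers oU hU) // divr_ge0 ?(ltW lp) //
    (d2alpha_ge0 hU).
move=> w; rewrite (derive2_randers oU hU) // => /eqP.
rewrite mulf_eq0 invr_eq0 (gt_eqF lp) orbF => /eqP; exact: (d2alpha_eq0 hU Ap).
Qed.

Lemma finsler_Fbar : finsler_metric U Fb.
Proof.
split.
- apply: continuous_in_subspaceT => p; rewrite inE => Up.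
  exact: (continuous_Fbar oU hU eta0 Up).
- exact: smooth_Fbar.
- exact: Fbar_gt0.
- exact: homogeneous_Fbar.
move=> p Ap; have lp : 0 < lam c p := lam_gt0 hU Ap.1.
have ap : 0 < alpha c p := alpha_gt0 hU Ap.
have K0 : 0 < eta / lam c p ^+ 2 by rewrite divr_gt0 // exprn_gt0.
have s0 : 0 < 1 - (beta c p / alpha c p) ^+ 2.
  rewrite subr_gt0 expr_div_n ltr_pdivrMr ?exprn_gt0 // mul1r.
  by rewrite (sqr_alpha hU Ap.1) (beta2_lt_quad hU).
have q0 (w : V) : 0 <= 2 / alpha c p * (2 * c * dotp p.1 w
          - beta c p / alpha c p * (inner c p w / alpha c p)) ^+ 2.
  by rewrite mulr_ge0 ?sqr_ge0 // divr_ge0 // ltW.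
have d0 w : 0 <= d2alpha c p w * (1 - (beta c p / alpha c p) ^+ 2).
  by rewrite mulr_ge0 ?(ltW s0) // (d2alpha_ge0 hU).
apply: (rank_fundamental oU) => //.
- exact: smooth_Fbar.
- exact: homogeneous_Fbar.
- exact: (Fbar_gt0 hU eta0 Ap).
- move=> w; rewrite (derive2_Fbar eta oU hU) // mulr_ge0 ?(ltW K0) //.
  by rewrite addr_ge0.
move=> w; rewrite (derive2_Fbar eta oU hU) // => /eqP.
rewrite mulf_eq0 (gt_eqF K0) /= (paddr_eq0 (d0 w) (q0 w)) => /andP[+ _].
rewrite mulf_eq0 (gt_eqF s0) orbF => /eqP; exact: (d2alpha_eq0 hU Ap).
Qed.

Lemma smooth_scale_randers (a : R) : smooth_on A (fun p => a * F p).
Proof.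
move=> k; apply: CkM; first exact: open_slit_tangent.
  exact: Ck_cst.
exact: smooth_randers.
Qed.

Lemma homogeneous_scale_randers (a : R) : homogeneous1 U (fun p => a * F p).
Proof. by move=> x y t Ux t0; rewrite (@homogeneous_randers _ _ c U) // mulrCA. Qed.

Lemma geodesic_spray_randers :
  is_geodesic_spray U F (fun p => S0 p - (2 * (c * F p)) *: liouville p).
Proof.
apply: (geodesic_spray (P := fun p => c * F p) oU).
- exact: smooth_randers.
- exact: smooth_scale_randers.
- exact: homogeneous_randers.
- exact: homogeneous_scale_randers.
- move=> p u Ap; exact: (flat_randers hU).
Qed.

Lemma geodesic_spray_Fbar :
  is_geodesic_spray U Fb (fun p => S0 p - (2 * (2 * c * F p)) *: liouville p).
Proof.
apply: (geodesic_spray (P := fun p => 2 * c * F p) oU).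
- exact: smooth_Fbar.
- exact: smooth_scale_randers.
- exact: homogeneous_Fbar.
- exact: homogeneous_scale_randers.
- move=> p u Ap; exact: (flat_Fbar eta hU).
Qed.

Lemma zero_flag_curvature_Fbar : zero_flag_curvature U Fb.
Proof.
exists (fun p => (2 * c * F p) *: p.2); split.
  rewrite (_ : spray _ = fun p => S0 p - (2 * (2 * c * F p)) *: liouville p).
    exact: geodesic_spray_Fbar.
  apply/funext => p; rewrite /spray /S0 /liouville [RHS]surjective_pairing.
  by congr pair; rewrite /= ?scaler0 ?subr0 // sub0r scalerA.
move=> p v Ap; rewrite !mul0r !scale0r subr0 /Phi.
congr pair; apply/rowP => i; rewrite !mxE big1 // => j _.
rewrite (Rcoef0 (P := fun p => 2 * c * F p) oU) ?mul0r //.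
- exact: smooth_scale_randers.
- exact: homogeneous_scale_randers.
- move=> q u Aq; have D w : 'D_w (fun p => 2 * c * F p) q = 2 * c * 'D_w F q.
    have [_ ->] := is_derive_mul (is_derive_const (2 * c) q w)
      (is_derive_randers hU w Aq).
    by rewrite mul0r add0r.
  by rewrite !D (funk_randers hU) //; move: ('D__ F q) => a; ring.
Qed.

Lemma projective_factor_Fbar x y : U x ->
  projective_factor Fb (x, y) = 2 * c * F (x, y).
Proof.
move=> Ux; have [->|y0] := eqVneq y 0.
  have F0 : F (x, 0) = 0 by rewrite randersE alpha0 /beta dotp0r mulr0 addr0 mul0r.
  have Fb0 : Fb (x, 0) = 0 by rewrite FbarE F0 !mulr0 mul0r.
  by rewrite /projective_factor F0 Fb0 !mulr0 invr0 mulr0.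
have Ap : slit_tangent U (x, y) by [].
rewrite /projective_factor /act (_ : S0 (x, y) = (y, 0)) // (flat_Fbar eta hU) //.
have dFb := smooth_is_derive (0, y) (smooth_Fbar eta oU hU) Ap.
have [_ ->] := is_derive_mul (is_derive_mul (is_derive_const (2 * c) _ _)
  (is_derive_randers hU (0, y) Ap)) dFb.
have -> : 'D_((0, y) : TV) F (x, y) = F (x, y).
  apply: (euler_slit (p := (x, y)) _ (smooth_randers oU hU)) => //.
  exact: homogeneous_randers.
have -> : 'D_((0, y) : TV) Fb (x, y) = Fb (x, y).
  apply: (euler_slit (p := (x, y)) _ (smooth_Fbar eta oU hU)) => //.
  exact: homogeneous_Fbar.
have := Fbar_gt0 hU eta0 Ap; move: (Fb _) (F _) => f g f0.
by field; exact: lt0r_neq0.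
Qed.

End FinslerMetrics.

Theorem mainTheorem10 (R : realType) (n : nat) (hn : (2 <= n)%N)
    (c eta : R) (hc : c != 0) (heta : 0 < eta)
    (U : set 'rV[R]_n) (Uopen : open U) (Uconvex : convex_set U)
    (hU : forall x, U x -> 4 * c ^+ 2 * enorm x ^+ 2 < 1) :
  [/\ finsler_metric U (Fbar c eta),
      projectively_flat U (Fbar c eta),
      zero_flag_curvature U (Fbar c eta),
      [/\ randers_metric U (randersF c),
          finsler_metric U (randersF c) &
          projectively_flat U (randersF c)] &
      exists2 k : R, k != 0 &
        forall x y : 'rV[R]_n, U x ->
          projective_factor (Fbar c eta) (x, y) = k * randersF c (x, y)].
Proof.
split.
- exact: finsler_Fbar.
- exists (fun p => 2 * c * randersF c p); split.
    exact: homogeneous_scale_randers.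
  exact: geodesic_spray_Fbar.
- exact: zero_flag_curvature_Fbar.
- split; [exact: randers_metric_randers|exact: finsler_randers|].
  exists (fun p => c * randersF c p); split.
    exact: homogeneous_scale_randers.
  exact: geodesic_spray_randers.
- exists (2 * c); first by rewrite mulf_neq0 // pnatr_eq0.
  by move=> x y Ux; exact: (projective_factor_Fbar Uopen hU heta y Ux).
Qed.
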